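(* Let $r>0$ be real, $0<p<1$, $q=1-p$, let $X\sim\mathrm{NB}(r,p)$, and suppose that the mean $\mu=rq/p$ is an integer with $\mu\ge1$. Then, exactly, $$\log\frac{\mathbb E|X-\mu|}{\frac1p\sqrt{2rq/\pi}}=\int_0^\infty\varphi(t)\,\Delta_r(t)\,dt,\qquad \Delta_r(t)=e^{-\frac rp t}-e^{-rt}-e^{-\frac{rq}{p}t},$$ and $\Delta_r(t)<0$ for every $t>0$. For $n\ge1$ let $$\tilde a_n(h)=\frac{(-1)^{n+1}}{n(n+1)}\Bigl[\bigl(p^n-(p/q)^n\bigr)B_{n+1}(h)-B_{n+1}\Bigr]$$ (the coefficients of the asymptotic series $\sum_{n\ge1}\tilde a_n(h)r^{-n}$ of $\log\bigl(\mathbb E|X-\mu|/(\frac1p\sqrt{2rq/\pi})\bigr)$, with $h=\lceil\mu\rceil-\mu$). At $h=0$ this series collapses to an odd series, i.e. $\tilde a_{2j}(0)=0$ for all $j\ge1$, with $$\tilde a_{2j-1}(0)=\frac{B_{2j}}{(2j-1)\,2j}\Bigl[p^{2j-1}-\Bigl(\frac pq\Bigr)^{2j-1}-1\Bigr],\qquad (-1)^j\,\tilde a_{2j-1}(0)>0\qquad(j\ge1),$$ and its successive partial sums strictly bracket the logarithm above: for every integer $M\ge0$, $$(-1)^{M+1}\Bigl[\log\frac{\mathbb E|X-\mu|}{\frac1p\sqrt{2rq/\pi}}-\sum_{j=1}^{M}\frac{\tilde a_{2j-1}(0)}{r^{2j-1}}\Bigr]>0 .$$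
   Context: $B_k(t)$ and $B_k=B_k(0)$ are the Bernoulli polynomials and numbers: $\frac{z e^{tz}}{e^z-1}=\sum_{k\ge0}B_k(t)\frac{z^k}{k!}$. $\mathrm{NB}(r,p)$ (failures parametrisation, $r>0$ real) has mass function $P(k)=\frac{\Gamma(k+r)}{\Gamma(r)\Gamma(k+1)}p^rq^k$, $k=0,1,2,\dots$. The function $\varphi$ is $\varphi(t)=\frac1t\bigl(\frac1{e^t-1}-\frac1t+\frac12\bigr)$, $t>0$. *)

(* Defs.v *)
From HB Require Import structures.
From mathcomp Require Import all_boot all_order all_algebra.
From mathcomp Require Import all_classical all_reals all_analysis.
Set Implicit Arguments.
Unset Strict Implicit.
Unset Printing Implicit Defensive.
Import Order.TTheory GRing.Theory Num.Theory.
Import numFieldNormedType.Exports.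
Local Open Scope classical_set_scope.
Local Open Scope ring_scope.

(* The real Gamma function, by Euler's integral; meaningful for 0 < x. *)
Definition Gamma (R : realType) (x : R) : R :=
  \int[lebesgue_measure]_(t in `]0, +oo[) (t `^ (x - 1) * expR (- t)).

(* The Bernoulli polynomials are specified by their exponential generating
   function.  Any such B is unique: a power series that converges in a punctured
   neighbourhood of 0 is determined by its sum there.  The point z = 0 is
   excluded because the right-hand side has a removable singularity. *)
Definition is_bernoulli_polys (R : realType) (B : nat -> {poly R}) : Prop :=
  forall t : R, \forall z \near (0 : R)^',
    series (fun k : nat => (B k).[t] * (z ^+ k / k`!%:R)) @ \oo -->
      z * expR (t * z) / (expR z - 1).

Definition bernoulli_num (R : realType) (B : nat -> {poly R}) (k : nat) : R :=
  (B k).[0].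

(* Failures parametrisation. *)
Definition nb_pmf (R : realType) (r p : R) (k : nat) : R :=
  Gamma (k%:R + r) / (Gamma r * Gamma (k%:R + 1)) * p `^ r * (1 - p) ^+ k.

(* X ~ NB(r, p).  The masses nb_pmf r p k sum to 1, so X is almost surely
   a natural number and its law is determined. *)
Definition has_nb_law d (T : measurableType d) (R : realType)
    (P : probability T R) (X : {RV P >-> R}) (r p : R) : Prop :=
  forall k : nat, distribution P X [set k%:R] = (nb_pmf r p k)%:E.

(* E|X - m| *)
Definition mean_abs_dev d (T : measurableType d) (R : realType)
    (P : probability T R) (X : {RV P >-> R}) (m : R) : \bar R :=
  'E_P[(fun w => `|X w - m|)].

Definition phi (R : realType) (t : R) : R :=
  t^-1 * ((expR t - 1)^-1 - t^-1 + 2^-1).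

Definition Delta (R : realType) (p r t : R) : R :=
  expR (- (r / p) * t) - expR (- r * t) - expR (- (r * (1 - p) / p) * t).

Definition atilde (R : realType) (B : nat -> {poly R}) (p : R) (n : nat)
    (h : R) : R :=
  let q := 1 - p in
  (-1) ^+ n.+1 / (n%:R * n.+1%:R) *
    ((p ^+ n - (p / q) ^+ n) * (B n.+1).[h] - bernoulli_num B n.+1).

(* Main.v *)
(** The telescoping identity T(k+1) - T(k) = (mu - k) f(k) with T(k) = k f(k) / p
    gives E|X - mu| = 2 T(mu) when mu is an integer, a quotient of rising factorials.
    If J(x) is the integral of phi(t) e^(-xt), then (x - 1/2) ln x - x + J(x) satisfies
    the functional equation of ln Gamma; since r/p = r + mu with mu an integer, this
    alone evaluates the logarithm as J(r/p) - J(r) - J(mu), up to the value at x = 1,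
    which comes from Wallis' product. Integrating by parts twice against the centred
    Bernoulli polynomials writes phi minus its Taylor polynomial as t^(2M) times a
    function of constant sign (-1)^M, and integrating against Delta < 0 gives the
    bracketing. The Bernoulli numbers of the generating function are identified with
    the values of these polynomials by uniqueness of power series coefficients. *)

Require Import Defs.
From HB Require Import structures.
From mathcomp Require Import all_boot all_order all_algebra.
From mathcomp Require Import all_classical all_reals all_analysis.
From mathcomp Require Import measurable_realfun.
From mathcomp Require Import zify ring lra.
Import Order.TTheory GRing.Theory Num.Theory.
Import numFieldNormedType.Exports.
Local Open Scope classical_set_scope.
Local Open Scope ring_scope.
Set Implicit Arguments.
Unset Strict Implicit.
Unset Printing Implicit Defensive.

(** * Differentiation rules for explicit expressions *)

Section derive_lambda.
Context {R : realType}.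
Implicit Types (f g : R -> R) (a b c x : R).

(** Only odd powers of 1/r occur because z phi(z) = coth(z/2)/2 - 1/z makes phi even. Its Taylor
    terms are B_2j/(2j)! t^(2j-2), and the moment of order 2j-2 of [Delta] is (2j-2)! r^(1-2j)
    (p^(2j-1) - 1 - (p/q)^(2j-1)); the product of the two is the term of index 2j-1. The sign of the
    remainder of phi is read off after multiplication by 2 sinh(z/2): the product is the integral
    over [0, 1/2] of 2 y sinh(z y), and each integration by parts splits off one Taylor term while
    keeping an integrand of known sign. The law of X is given by the masses of the points k alone.
    That X avoids everything else follows from the masses summing to 1, that is from the series of
    (1 - x)^(-r) for real r, obtained from an exact formula for the derivative of (1 - x)^r times a
    partial sum. Logarithms enter the functional equation of J through Frullani's integral, which is
    proved by subdivision. *)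

Lemma is_dcst c x : is_derive x 1 (fun _ : R => c) (0 : R).
Proof. exact: is_derive_cst. Qed.

Lemma is_did x : is_derive x 1 (fun t : R => t) (1 : R).
Proof. exact: is_derive_id. Qed.

Lemma is_dadd f g x a b : is_derive x 1 f a -> is_derive x 1 g b ->
  is_derive x 1 (fun t => f t + g t : R) (a + b : R).
Proof. move=> df dg; exact: is_deriveD. Qed.

Lemma is_dopp f x a : is_derive x 1 f a -> is_derive x 1 (fun t => - f t : R) (- a : R).
Proof. move=> df; exact: is_deriveN. Qed.

Lemma is_dmul f g x a b : is_derive x 1 f a -> is_derive x 1 g b ->
  is_derive x 1 (fun t => f t * g t : R) (a * g x + f x * b : R).
Proof.
move=> df dg; apply: (is_derive_eq (is_deriveM df dg)).
by rewrite /GRing.scale/= addrC mulrC.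
Qed.

Lemma is_dexp f x a : is_derive x 1 f a ->
  is_derive x 1 (fun t => expR (f t)) (expR (f x) * a : R).
Proof. move=> df; exact: is_derive1_comp. Qed.

Lemma is_dX f n x a : is_derive x 1 f a ->
  is_derive x 1 (fun t => f t ^+ n : R) (n%:R * f x ^+ n.-1 * a : R).
Proof.
move=> df; rewrite (_ : (fun _ => _) = f ^+ n); last by rewrite exprfctE.
exact: is_deriveX.
Qed.

Lemma is_dinv f x a : f x != 0 -> is_derive x 1 f a ->
  is_derive x 1 (fun t => (f t)^-1 : R) (- (a / f x ^+ 2) : R).
Proof.
move=> fx df; have h := @is_deriveV R f x a 1 fx df.
apply: (is_derive_eq h).
by rewrite /GRing.scale/= mulNr mulrC.
Qed.

Lemma is_dln f x a : 0 < f x -> is_derive x 1 f a ->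
  is_derive x 1 (fun t => ln (f t)) ((f x)^-1 * a : R).
Proof. by move=> fx df; apply: is_derive1_comp; exact: is_derive1_ln. Qed.

Lemma is_dpowR f x a s : 0 < f x -> is_derive x 1 f a ->
  is_derive x 1 (fun t => f t `^ s) (s * f x `^ (s - 1) * a : R).
Proof.
move=> fx df; have h := @is_derive1_powR R s _ fx.
exact: (is_derive1_comp h df).
Qed.

Lemma is_dhorner (p : {poly R}) x : is_derive x 1 (fun t => p.[t]) (p^`().[x] : R).
Proof. exact: is_derive_poly. Qed.

Lemma is_derive1_eq f x a b : is_derive x 1 f a -> a = b -> is_derive x 1 f b.
Proof. by move=> ? <-. Qed.

Lemma is_derive1_derivable f x a : is_derive x 1 f a -> derivable f x 1.
Proof. by case. Qed.

Lemma is_derive1_continuous f x a : is_derive x 1 f a -> {for x, continuous f}.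
Proof. by case=> df _; exact/differentiable_continuous/derivable1_diffP. Qed.

End derive_lambda.

(* Type class search on is_derive is avoided: it instantiates the derivative in an
   unpredictable form and may take minutes. *)
Ltac derive_step :=
  first [ notypeclasses refine (is_dcst _ _) | notypeclasses refine (is_did _)
        | notypeclasses refine (is_dhorner _ _) | eassumption
        | notypeclasses refine (is_dadd _ _) | notypeclasses refine (is_dopp _)
        | notypeclasses refine (is_dmul _ _) | notypeclasses refine (is_dX _ _)
        | notypeclasses refine (is_dexp _) | notypeclasses refine (is_dinv _ _)
        | notypeclasses refine (is_dln _ _) | notypeclasses refine (is_dpowR _ _ _) ].
Ltac derive := notypeclasses refine (is_derive1_eq _ _); [repeat derive_step
  | cbv beta; rewrite ?(mul0r, mulr0, add0r, addr0, mulr1, mul1r, subr0, sub0r, oppr0)].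

(** * Integrals over the open half-line *)

Section halfline.
Context {R : realType}.
Implicit Types (f F : R -> R) (a b x : R).
Local Notation leb := (@lebesgue_measure R).
Local Notation D := ([set` `]0%R, +oo[] : set R).

Lemma measurable_halfline : measurable (D : set (measurableTypeR R)).
Proof. exact: measurable_itv. Qed.
#[local] Hint Resolve measurable_halfline : core.

Definition continuous_pos f := forall x, 0 < x -> {for x, continuous f}.

Lemma continuous_pos_in f : continuous_pos f -> {in D, continuous f}.
Proof. by move=> cf x; rewrite inE/= in_itv/= andbT; exact: cf. Qed.

Lemma continuous_pos_measurable f : continuous_pos f -> measurable_fun D f.
Proof.
move=> cf; apply: open_continuous_measurable_fun; first exact: interval_open.
exact: continuous_pos_in.
Qed.

Lemma bigcup_itv_inv_y : \bigcup_n [set` `[(n.+1%:R^-1 : R), +oo[] = D.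
Proof.
apply/seteqP; split=> [x [n _]|x] /=; rewrite !in_itv/= !andbT.
  by apply: lt_le_trans; rewrite invr_gt0.
move=> x0; exists (Num.truncn x^-1) => //=; rewrite in_itv/= andbT.
rewrite -[leRHS]invrK lef_pV2 ?posrE ?invr_gt0//.
by apply: ltW; apply: truncnS_gt.
Qed.

Lemma bigcup_itv_inv_n : \bigcup_n [set` `[(n.+1%:R^-1 : R), n.+1%:R]] = D.
Proof.
apply/seteqP; split=> [x [n _]|x] /=; rewrite !in_itv/= !andbT.
  by move=> /andP[+ _]; apply: lt_le_trans; rewrite invr_gt0.
move=> x0; exists (maxn (Num.truncn x^-1) (Num.truncn x)) => //=; rewrite in_itv/=.
apply/andP; split.
  rewrite -[leRHS]invrK lef_pV2 ?posrE ?invr_gt0//.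
  apply: (le_trans (ltW (truncnS_gt _))).
  by rewrite ler_nat ltnS leq_maxl.
apply: (le_trans (ltW (truncnS_gt _))).
by rewrite ler_nat ltnS leq_maxr.
Qed.

Lemma cvg_invSn F a : F x @[x --> (0:R)^'+] --> a -> F (n.+1%:R^-1) @[n --> \oo] --> a.
Proof.
move=> /cvg_at_rightP; apply; split; first by move=> n; rewrite invr_gt0.
exact: cvg_harmonic.
Qed.

Lemma cvg_natS F a : F x @[x --> +oo%R] --> a -> F (n.+1%:R) @[n --> \oo] --> a.
Proof.
move=> /cvg_pinftyP; apply; apply/cvgryPge => r.
near=> n; rewrite (@le_trans _ _ n%:R) ?ler_nat//; near: n; exact: nbhs_infty_ger.
Unshelve. all: by end_near. Qed.

(** Monotone convergence along the intervals [1/(n+1), +oo[. Since f is nonnegative, the finite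
    limits of F already yield integrability. *)
Lemma ge0_FTC_halfline f F a b :
  (forall x, 0 < x -> 0 <= f x) -> continuous_pos f ->
  (forall x, 0 < x -> is_derive x 1 F (f x)) ->
  F x @[x --> (0:R)^'+] --> a -> F x @[x --> +oo%R] --> b ->
  leb.-integrable D (EFin \o f) /\ \int[leb]_(x in D) f x = b - a.
Proof.
move=> f0 cf dF Fa Fb.
have cF x : 0 < x -> {for x, continuous F}.
  by move=> /dF; exact: is_derive1_continuous.
have key : (\int[leb]_(x in D) (f x)%:E)%E = (b - a)%:E.
  pose E n := [set` `[(n.+1%:R^-1 : R), +oo[].
  rewrite -bigcup_itv_inv_y -/E.
  have nd : nondecreasing_seq E.
    move=> m n mn; rewrite subsetEset; apply: subset_itvr; rewrite bnd_simp.
    by rewrite lef_pV2 ?posrE// ler_nat ltnS.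
  have h : (\int[leb]_(x in E n) (f x)%:E)%E @[n --> \oo] -->
      (\int[leb]_(x in \bigcup_n E n) (f x)%:E)%E.
    apply: ge0_nondecreasing_set_cvg_integral => //.
    + by move=> i; exact: measurable_itv.
    + move=> i; apply/measurable_EFinP.
      apply: measurable_funS (continuous_pos_measurable cf) => //.
      by rewrite -bigcup_itv_inv_y; exact: bigcup_sup.
    + move=> i x; rewrite /E/= in_itv/= andbT => ix.
      by rewrite lee_fin f0// (lt_le_trans _ ix)// invr_gt0.
  apply: (cvg_unique _ h) => //.
  rewrite (_ : (fun _ => _) = fun n : nat => (b - F (n.+1%:R^-1))%:E).
    apply: cvg_EFin; first exact: nearW.
    by apply: cvgB; [exact: cvg_cst|exact: cvg_invSn].
  apply/funext => n; have n0 : 0 < (n.+1%:R^-1 : R) by rewrite invr_gt0.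
  rewrite /= (@ge0_continuous_FTC2y _ f F _ b)//.
  + by move=> x nx; apply: f0; exact: lt_le_trans nx.
  + apply/continuous_within_itvcyP; split.
      by move=> x; rewrite in_itv/= andbT => nx; apply: cf; exact: lt_trans nx.
    by apply: cvg_at_right_filter; exact: cf.
  + by move=> x nx; apply: is_derive1_derivable (dF _ (lt_trans n0 nx)).
  + by apply: cvg_at_right_filter; exact: cF.
  + move=> x; rewrite in_itv/= andbT => nx; rewrite derive1E.
    by have := dF _ (lt_trans n0 nx) => -[_ ->].
split; last by rewrite /Rintegral key.
apply/integrableP; split; first by apply/measurable_EFinP; exact: continuous_pos_measurable.
have -> : (\int[leb]_(x in D) `|(EFin \o f) x|)%E = (\int[leb]_(x in D) (f x)%:E)%E.
  apply: eq_integral => x; rewrite inE/= in_itv/= andbT => x0.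
  by rewrite ger0_norm// f0.
by rewrite key ltry.
Qed.

(** For f of varying sign, the positive and negative parts converge separately along compact
    intervals exhausting the half-line; integrability makes the difference of their limits
    meaningful. *)
Lemma FTC_halfline f F a b :
  leb.-integrable D (EFin \o f) -> continuous_pos f ->
  (forall x, 0 < x -> is_derive x 1 F (f x)) ->
  F x @[x --> (0:R)^'+] --> a -> F x @[x --> +oo%R] --> b ->
  \int[leb]_(x in D) f x = b - a.
Proof.
move=> If cf dF Fa Fb.
have cF x : 0 < x -> {for x, continuous F}.
  by move=> /dF; exact: is_derive1_continuous.
(* The shift by 2 keeps the endpoints distinct for n = 0 as well. *)
pose E n := [set` `[(n.+2%:R^-1 : R), n.+2%:R]].
have ED : \bigcup_n E n = D.
  rewrite -bigcup_itv_inv_n; apply/seteqP; split=> x [n _] xn.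
    by exists n.+1.
  exists n => //; move: xn; rewrite /= !in_itv/= => /andP[h1 h2]; apply/andP; split.
    by apply: le_trans h1; rewrite lef_pV2 ?posrE// ler_nat.
  by apply: (le_trans h2); rewrite ler_nat.
have nd : nondecreasing_seq E.
  move=> m n mn; rewrite subsetEset /E => x /=; rewrite !in_itv/= => /andP[h1 h2]; apply/andP; split.
    by apply: le_trans h1; rewrite lef_pV2 ?posrE// ler_nat !ltnS.
  by apply: (le_trans h2); rewrite ler_nat !ltnS.
have mE i : measurable (E i) by exact: measurable_itv.
have Esub i : E i `<=` D by rewrite -ED; exact: bigcup_sup.
have mf := continuous_pos_measurable cf.
have h : (\int[leb]_(x in E n) (f x)%:E)%E @[n --> \oo] --> (\int[leb]_(x in D) (f x)%:E)%E.
  rewrite integralE; under eq_fun do rewrite integralE.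
  have mfE : measurable_fun D (EFin \o f) by exact/measurable_EFinP.
  apply: cvgeB.
  - apply: fin_num_adde_defl; rewrite fin_numN.
    have [fpos fneg] : (\int[leb]_(x in D) (EFin \o f)^\+ x)%E \is a fin_num /\
      (\int[leb]_(x in D) (EFin \o f)^\- x)%E \is a fin_num.
      by split; [exact: integrable_pos_fin_num|exact: integrable_neg_fin_num].
    exact: fneg.
  - rewrite -ED; apply: ge0_nondecreasing_set_cvg_integral => //.
    by move=> i; apply: measurable_funepos; apply: measurable_funS mfE.
  - rewrite -ED; apply: ge0_nondecreasing_set_cvg_integral => //.
    by move=> i; apply: measurable_funeneg; apply: measurable_funS mfE.
have h2 : (\int[leb]_(x in E n) (f x)%:E)%E @[n --> \oo] --> (b - a)%:E.
  rewrite (_ : (fun _ => _) = fun n : nat => (F n.+2%:R - F (n.+2%:R^-1))%:E).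
    apply: cvg_EFin; first exact: nearW.
    have FbS : F n.+2%:R @[n --> \oo] --> b.
      by rewrite (cvg_shiftS (fun n => F n.+1%:R)); exact: cvg_natS.
    have FaS : F (n.+2%:R^-1) @[n --> \oo] --> a.
      by rewrite (cvg_shiftS (fun n => F (n.+1%:R^-1))); exact: cvg_invSn.
    exact: cvgB.
  apply/funext => n.
  have n0 : 0 < (n.+2%:R^-1 : R) by rewrite invr_gt0.
  have n1 : (n.+2%:R^-1 : R) < n.+2%:R.
    by rewrite (@lt_trans _ _ 1)// ?ltr1n// invf_lt1// ltr1n.
  rewrite (@continuous_FTC2 _ f F)//.
  - apply: continuous_in_subspaceT => x; rewrite inE => /Esub/=.
    by rewrite in_itv/= andbT; exact: cf.
  - split.
    + move=> x; rewrite in_itv/= => /andP[nx _].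
      by apply: is_derive1_derivable (dF _ (lt_trans n0 nx)).
    + by apply: cvg_at_right_filter; exact: cF.
    + by apply: cvg_at_left_filter; apply: cF; exact: lt_trans n1.
  - move=> x; rewrite in_itv/= => /andP[nx _]; rewrite derive1E.
    by have := dF _ (lt_trans n0 nx) => -[_ ->].
rewrite /Rintegral.
by have /= -> := cvg_unique _ h h2.
Qed.

(** A vanishing integral would force f = 0 almost everywhere, so the half-line would lie in a null
    set. *)
Lemma Rintegral_halfline_gt0 f : leb.-integrable D (EFin \o f) ->
  (forall x, 0 < x -> 0 < f x) -> 0 < \int[leb]_(x in D) f x.
Proof.
move=> If f0.
rewrite lt_neqAle Rintegral_ge0 ?andbT; last first.
  by move=> x /=; rewrite in_itv/= andbT => /f0/ltW.
apply/eqP => h0.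
have := integrable_fin_num measurable_halfline If => fin.
have : (\int[leb]_(x in D) `|(f x)%:E|)%E = 0%E.
  have -> : (\int[leb]_(x in D) `|(f x)%:E|)%E = (\int[leb]_(x in D) (f x)%:E)%E.
    apply: eq_integral => x; rewrite inE/= in_itv/= andbT => x0.
    by rewrite ger0_norm// ltW// f0.
  rewrite -[LHS]fineK//=; congr (_%:E); exact/esym/h0.
have mf : measurable_fun D (EFin \o f) by apply: measurable_int If.
move/(ae_eq_integral_abs _ measurable_halfline mf) => [N [mN N0 sub]].
have : (leb D <= leb N)%E.
  apply: le_measure; rewrite ?inE//.
  move=> x Dx; apply: sub => /= h; have := h Dx; move=> /= -[fx0].
  by move: Dx; rewrite /= in_itv/= andbT => /f0; rewrite fx0 ltxx.
by rewrite N0 lebesgue_measure_itv/= ltry.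
Qed.

Lemma is_derive_continuous_pos f f' : (forall x, 0 < x -> is_derive x 1 f (f' x)) -> continuous_pos f.
Proof. by move=> df x /df; exact: is_derive1_continuous. Qed.

Lemma dominated_integrable f g : continuous_pos f -> leb.-integrable D (EFin \o g) ->
  (forall x, 0 < x -> `|f x| <= g x) -> leb.-integrable D (EFin \o f).
Proof.
move=> cf Ig fg; apply: (le_integrable measurable_halfline _ _ Ig).
  by apply/measurable_EFinP; exact: continuous_pos_measurable.
move=> x /=; rewrite in_itv/= andbT => x0.
by rewrite lee_fin (le_trans (fg _ x0)) ?ler_norm.
Qed.

Lemma eq_Rintegral_halfline f g : (forall x, 0 < x -> f x = g x) ->
  \int[leb]_(x in D) f x = \int[leb]_(x in D) g x.
Proof.
by move=> fg; apply: eq_Rintegral => x; rewrite inE/= in_itv/= andbT; exact: fg.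
Qed.

Lemma eq_integrable_halfline f g : (forall x, 0 < x -> f x = g x) ->
  leb.-integrable D (EFin \o f) -> leb.-integrable D (EFin \o g).
Proof.
move=> fg; apply: eq_integrable => // x; rewrite inE/= in_itv/= andbT => x0.
by rewrite fg.
Qed.

Lemma integrableD_halfline f g : leb.-integrable D (EFin \o f) -> leb.-integrable D (EFin \o g) ->
  leb.-integrable D (EFin \o (fun x => f x + g x)).
Proof. by move=> If Ig; exact: (integrableD measurable_halfline If Ig). Qed.

Lemma integrableN_halfline f : leb.-integrable D (EFin \o f) ->
  leb.-integrable D (EFin \o (fun x => - f x)).
Proof. by move=> If; exact: (integrableN If). Qed.

Lemma integrableZ_halfline f c : leb.-integrable D (EFin \o f) ->
  leb.-integrable D (EFin \o (fun x => c * f x)).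
Proof. by move=> If; exact: (integrableZl measurable_halfline c If). Qed.

Lemma RintegralD_halfline f g : leb.-integrable D (EFin \o f) -> leb.-integrable D (EFin \o g) ->
  \int[leb]_(x in D) (f x + g x) = \int[leb]_(x in D) f x + \int[leb]_(x in D) g x.
Proof. by move=> If Ig; have := RintegralD measurable_halfline If Ig. Qed.

Lemma RintegralB_halfline f g : leb.-integrable D (EFin \o f) -> leb.-integrable D (EFin \o g) ->
  \int[leb]_(x in D) (f x - g x) = \int[leb]_(x in D) f x - \int[leb]_(x in D) g x.
Proof. by move=> If Ig; have := RintegralB measurable_halfline If Ig. Qed.

Lemma RintegralZ_halfline f c : leb.-integrable D (EFin \o f) ->
  \int[leb]_(x in D) (c * f x) = c * \int[leb]_(x in D) f x.
Proof. by move=> If; have := RintegralZl c measurable_halfline If. Qed.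

Lemma le_Rintegral_halfline f g : leb.-integrable D (EFin \o f) -> leb.-integrable D (EFin \o g) ->
  (forall x, 0 < x -> f x <= g x) ->
  \int[leb]_(x in D) f x <= \int[leb]_(x in D) g x.
Proof.
move=> If Ig fg; apply: (le_Rintegral measurable_halfline If Ig) => x /=.
by rewrite in_itv/= andbT; exact: fg.
Qed.

Lemma cvg_pinfty_le f a C : (forall x, 0 < x -> `|f x - a| <= C / x) ->
  f x @[x --> +oo%R] --> a.
Proof.
move=> fC; apply/cvgrPdist_le => e e0; near=> x.
have x0 : 0 < x by near: x; exact: nbhs_pinfty_gt.
rewrite distrC (le_trans (fC _ x0))// ler_pdivrMr// mulrC -ler_pdivrMr//.
Unshelve. all: by end_near. Qed.

Lemma cvg0_right f g a : (forall x, 0 < x -> `|f x - a| <= g x) ->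
  g x @[x --> (0:R)^'+] --> (0 : R) -> f x @[x --> (0:R)^'+] --> a.
Proof.
move=> fg g0; apply/cvgrPdist_le => e e0.
move/cvgr0Pnorm_le : g0 => /(_ _ e0) g0; near=> x.
have x0 : 0 < x by [].
rewrite distrC (le_trans (fg _ x0))// (le_trans (ler_norm _))//.
by near: x; exact: g0.
Unshelve. all: by end_near. Qed.

Lemma cvg_right_id : (fun x : R => x) x @[x --> (0:R)^'+] --> (0 : R).
Proof. by apply: cvg_at_right_filter; exact: cvg_id. Qed.

Lemma eq0_of_le_inv x C : (forall n : nat, `|x| <= C / n.+1%:R) -> x = 0.
Proof.
move=> h; apply/eqP; rewrite -normr_eq0 -[_ == 0]negbK; apply/negP => e0.
set e := `|_| in h e0; have {}e0 : 0 < e by rewrite lt_neqAle eq_sym e0 normr_ge0.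
have := h (Num.truncn (C / e)); rewrite leNgt => /negP; apply.
by rewrite ltr_pdivrMr// [e * _]mulrC -ltr_pdivrMr// truncnS_gt.
Qed.

Lemma cvg_nat_le (u v : nat -> R) a : (forall n, `|u n - a| <= v n) ->
  v n @[n --> \oo] --> (0 : R) -> u n @[n --> \oo] --> a.
Proof.
move=> uv v0; apply/cvgrPdist_le => e e0.
move/cvgr0Pnorm_le : v0 => /(_ _ e0) v0; near=> n.
rewrite distrC (le_trans (uv n))// (le_trans (ler_norm _))//.
by near: n; exact: v0.
Unshelve. all: by end_near. Qed.

End halfline.

(** * The Gamma function and exponential moments *)

Section gamma.
Context {R : realType}.
Local Notation leb := (@lebesgue_measure R).
Local Notation D := ([set` `]0%R, +oo[] : set R).
Implicit Types (x t a : R) (n : nat).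

Lemma Xn_expR_bound n a t : 0 < a -> 0 < t ->
  t ^+ n * expR (- a * t) <= n.+1`!%:R / a ^+ n.+1 / t.
Proof.
move=> a0 t0; have at0 : 0 < a * t by rewrite mulr_gt0.
have /(le_trans _) h := expR_ge1Dxn n (ltW at0).
have {h} h : (a * t) ^+ n.+1 / n.+1`!%:R <= expR (a * t) by apply: h; rewrite lerDr.
have e0 := expR_gt0 (a * t).
have f0 : 0 < n.+1`!%:R :> R by rewrite ltr0n fact_gt0.
rewrite mulNr expRN ler_pdivlMr// mulrAC ler_pdivrMr// -exprSr.
rewrite ler_pdivrMr// in h.
rewrite mulrAC ler_pdivlMr ?exprn_gt0// -exprMn [t * a]mulrC (le_trans h)// mulrC.
by [].
Qed.

Lemma Xn_expR_cvgy n a : 0 < a -> t ^+ n * expR (- a * t) @[t --> +oo%R] --> (0 : R).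
Proof.
move=> a0; apply: (@cvg_pinfty_le _ _ _ (n.+1`!%:R / a ^+ n.+1)) => t t0.
rewrite subr0 ger0_norm; first exact: Xn_expR_bound.
by rewrite mulr_ge0 ?expR_ge0 ?exprn_ge0// ltW.
Qed.

(** Antiderivative of t^n e^(-a t) produced by integration by parts. It equals -n!/a^(n+1) at 0 and
    tends to 0 at infinity. *)
Fixpoint Xn_expR_prim n a t : R := if n is m.+1 then
  a^-1 * (m.+1%:R * Xn_expR_prim m a t - t ^+ n * expR (- a * t))
  else - (a^-1 * expR (- a * t)).

Lemma is_derive_Xn_expR_prim n a t : a != 0 ->
  is_derive t 1 (Xn_expR_prim n a) (t ^+ n * expR (- a * t)).
Proof.
move=> a0; elim: n => [|n IH] /=.
  by derive; field.
by derive; rewrite /= exprS; field.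
Qed.

Lemma Xn_expR_integral n a : 0 < a ->
  leb.-integrable D (EFin \o (fun t => t ^+ n * expR (- a * t))) /\
  \int[leb]_(t in D) (t ^+ n * expR (- a * t)) = n`!%:R / a ^+ n.+1.
Proof.
move=> a0; have an0 : a != 0 by rewrite gt_eqF.
have dF t : is_derive t 1 (Xn_expR_prim n a) (t ^+ n * expR (- a * t)).
  exact: is_derive_Xn_expR_prim.
have F0 : Xn_expR_prim n a 0 = - (n`!%:R / a ^+ n.+1).
  elim: n {dF} => [|n IH] /=; first by rewrite mulr0 expR0 mul1r mulr1.
  rewrite IH expr0n/= mul0r subr0 factS natrM [in RHS]exprS; field.
  by rewrite expf_neq0 ?an0.
have Fy : Xn_expR_prim n a t @[t --> +oo%R] --> (0 : R).
  elim: n {dF F0} => [|n IH] /=.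
    rewrite -oppr0 -(mulr0 a^-1); apply: cvgN; apply: cvgM; first exact: cvg_cst.
    have := @Xn_expR_cvgy 0 a a0.
    by under eq_fun do rewrite expr0 mul1r.
  rewrite -(mulr0 a^-1); apply: cvgM; first exact: cvg_cst.
  rewrite -(subr0 0) -{1}(mulr0 n.+1%:R); apply: cvgB; last exact: Xn_expR_cvgy.
  by apply: cvgM => //; exact: cvg_cst.
rewrite -[RHS]opprK -F0 -sub0r; apply: (@ge0_FTC_halfline _ _ (Xn_expR_prim n a)) => //.
- by move=> t t0; rewrite mulr_ge0 ?expR_ge0 ?exprn_ge0// ltW.
- move=> t _; suff: is_derive t 1 (fun t => t ^+ n * expR (- a * t))
     (n%:R * t ^+ n.-1 * expR (- a * t) - a * t ^+ n * expR (- a * t)).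
    exact: is_derive1_continuous.
  derive; ring.
- by apply: cvg_at_right_filter; apply: is_derive1_continuous (dF 0).
Qed.

(** With s = x + 1 >= 1, raise 1 + t <= s e^(t/s) to the power s. *)
Lemma powR_expR_bound x t : 0 < x -> 0 < t ->
  expR (- t) <= (x + 1) `^ (x + 1) * (1 + t) `^ (- (x + 1)).
Proof.
move=> x0 t0; set s := x + 1.
have s1 : 1 <= s by rewrite /s lerDr ltW.
have s0 : 0 < s by rewrite (lt_le_trans _ s1).
have t1 : 0 < 1 + t by rewrite addr_gt0.
have h : 1 + t <= s * expR (t / s).
  apply: (@le_trans _ _ (s * (1 + t / s))).
    by rewrite mulrDr mulr1 mulrC divfK ?gt_eqF// lerD2r.
  by rewrite ler_pM2l// expR_ge1Dx.
have h2 : (1 + t) `^ s <= s `^ s * expR t.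
  have e : t = t / s * s by rewrite divfK ?gt_eqF.
  rewrite [X in expR X]e expRM -powRM ?expR_ge0 ?(ltW s0)//.
  by apply: ge0_ler_powR; rewrite ?nnegrE ?mulr_ge0 ?expR_ge0// ltW.
rewrite powRN expRN ler_pdivlMr ?powR_gt0// mulrC ler_pdivrMr ?expR_gt0//.
Qed.

(** The majorant, a multiple of t^(x-1) (1+t)^(-x-1), has the explicit antiderivative (t/(1+t))^x /
    x, which handles the singularity at 0 (when x < 1) and the decay at infinity together. *)
Lemma Gamma_integrable x : 0 < x ->
  leb.-integrable D (EFin \o (fun t => t `^ (x - 1) * expR (- t))).
Proof.
move=> x0.
pose F t := ((x + 1) `^ (x + 1) / x) * (t / (1 + t)) `^ x.
pose f t := (x + 1) `^ (x + 1) * (t `^ (x - 1) * (1 + t) `^ (- (x + 1))).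
have dF t : 0 < t -> is_derive t 1 F (f t).
  move=> t0; have t1 : 0 < 1 + t by rewrite addr_gt0.
  rewrite /F; derive; [by rewrite divr_gt0|by rewrite gt_eqF|].
  have e1 : (t / (1 + t)) `^ (x - 1) = t `^ (x - 1) * (1 + t) `^ (- (x - 1)).
    rewrite powRM ?invr_ge0 ?(ltW t0) ?(ltW t1)//; congr (_ * _).
    by rewrite -(powR_inv1 (ltW t1)) -powRrM mulN1r.
  have e2 : (1 + t) `^ (- (x + 1)) = (1 + t) `^ (- (x - 1)) / (1 + t) ^+ 2.
    rewrite -(powR_mulrn 2 (ltW t1)) -powRB; last by rewrite (gt_eqF t1) implybT.
    by congr (_ `^ _); rewrite opprB opprD -addrA; lra.
  rewrite /f e1 e2; field; by rewrite !gt_eqF.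
have [If _] : leb.-integrable D (EFin \o f) /\
    \int[leb]_(t in D) f t = (x + 1) `^ (x + 1) / x - 0.
  apply: (@ge0_FTC_halfline _ _ F) => //.
  - move=> t t0; rewrite /f !mulr_ge0 ?powR_ge0//.
  - apply: (@is_derive_continuous_pos _ _ (fun t => (x + 1) `^ (x + 1) * ( ((x-1) * t `^ (x - 1 - 1)) * (1 + t) `^ (- (x + 1)) + t `^ (x-1) * (- (x + 1) * (1+t)`^(-(x+1)-1))))) => t t0.
    by rewrite /f; derive => //; first [by rewrite addr_gt0|ring].
  - apply: (@cvg0_right _ _ (fun t => ((x + 1) `^ (x + 1) / x) * t `^ x)).
      move=> t t0; have t1 : 0 < 1 + t by rewrite addr_gt0.
      rewrite subr0 ger0_norm /F ?mulr_ge0 ?powR_ge0 ?invr_ge0 ?(ltW x0)//.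
      apply: ler_wpM2l; first by rewrite mulr_ge0 ?powR_ge0 ?invr_ge0 ?(ltW x0).
      apply: (ge0_ler_powR (ltW x0)); rewrite ?nnegrE.
      - by rewrite ltW// divr_gt0.
      - exact: ltW.
      - by rewrite ler_pdivrMr// ler_peMr ?(ltW t0)// lerDl ltW.
    rewrite -[X in _ --> X](mulr0 ((x + 1) `^ (x + 1) / x)); apply: cvgM; first exact: cvg_cst.
    exact: powR_cvg0.
  - rewrite -[X in _ --> X]mulr1; apply: cvgM; first exact: cvg_cst.
    have c1 : {for 1, continuous (fun u : R => u `^ x)}.
      by apply: is_derive1_continuous; apply: (@is_derive1_powR R x 1).
    have p1 : (1 : R) `^ x = 1 by rewrite powR1.
    rewrite -[X in _ --> X]p1.
    apply: (@cvg_comp _ _ _ (fun t => t / (1 + t)) (fun u : R => u `^ x) _ (nbhs (1:R))); last exact: c1.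
    apply: (@cvg_pinfty_le _ _ _ 1) => t t0; have t1 : 0 < 1 + t by rewrite addr_gt0.
    have -> : t / (1 + t) - 1 = - (1 + t)^-1 by field; rewrite gt_eqF.
    by rewrite normrN ger0_norm ?invr_ge0 ?(ltW t1)// mul1r lef_pV2 ?posrE// lerDr.
apply: dominated_integrable If _ => [|t t0].
  apply: (@is_derive_continuous_pos _ _ (fun t => (x-1) * t `^ (x - 1 - 1) * expR (- t) - t `^ (x-1) * expR (- t))) => t t0.
  derive => //; try ring.
rewrite /f mulrCA ger0_norm ?mulr_ge0 ?powR_ge0 ?expR_ge0//.
by rewrite ler_wpM2l ?powR_ge0// powR_expR_bound.
Qed.

Lemma Gamma_gt0 x : 0 < x -> 0 < Gamma x.
Proof.
move=> x0; apply: Rintegral_halfline_gt0; first exact: Gamma_integrable.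
by move=> t t0; rewrite mulr_gt0 ?powR_gt0 ?expR_gt0.
Qed.

(** The difference of the two integrands is the derivative of t^x e^(-t), which vanishes at both
    ends. *)
Lemma GammaS x : 0 < x -> Gamma (x + 1) = x * Gamma x.
Proof.
move=> x0; have x10 : 0 < x + 1 by rewrite addr_gt0.
have I0 := Gamma_integrable x0; have := Gamma_integrable x10.
rewrite /Gamma addrK => I1; apply/esym/eqP; rewrite -subr_eq0 -RintegralZ_halfline//.
have I0x := integrableZ_halfline x I0.
rewrite -RintegralB_halfline//.
apply/eqP; transitivity (0 - 0 : R); last by rewrite subr0.
apply: (@FTC_halfline _ _ (fun t => t `^ x * expR (- t))) => //.
- exact: (integrableD_halfline I0x (integrableN_halfline I1)).
- apply: (@is_derive_continuous_pos _ _ (fun t => x * ((x-1) * t `^ (x - 1 - 1) * expR (- t) - t `^ (x-1) * expR (- t)) - (x * t `^ (x - 1) * expR (- t) - t `^ x * expR (- t)))) => t t0.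
  by derive => //; try ring.
- by move=> t t0; derive => //; try ring.
- apply: (@cvg0_right _ _ (fun t => t `^ x)); last exact: powR_cvg0.
  move=> t t0; rewrite subr0 ger0_norm ?mulr_ge0 ?powR_ge0 ?expR_ge0//.
  by rewrite ler_piMr ?powR_ge0// expR_le1 oppr_le0 ltW.
- apply: (@cvg_pinfty_le _ _ _ ((x + 1) `^ (x + 1))) => t t0.
  have t1 : 0 < 1 + t by rewrite addr_gt0.
  rewrite subr0 ger0_norm ?mulr_ge0 ?powR_ge0 ?expR_ge0//.
  apply: (le_trans (ler_wpM2l (powR_ge0 _ _) (powR_expR_bound x0 t0))).
  rewrite mulrCA ler_wpM2l ?powR_ge0// opprD powRD ?(gt_eqF t1) ?implybT//.
  rewrite (powR_inv1 (ltW t1)) mulrA powRN; apply: (@le_trans _ _ (1 + t)^-1).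
    rewrite ler_piMl ?invr_ge0 ?(ltW t1)// ler_pdivrMr ?powR_gt0// mul1r.
    by apply: (ge0_ler_powR (ltW x0)); rewrite ?nnegrE ?(ltW t0) ?(ltW t1)// lerDr.
  by rewrite lef_pV2 ?posrE// lerDr.
Qed.

Lemma Gamma1 : Gamma (1 : R) = 1.
Proof.
have [_ h] := @Xn_expR_integral 0 1 ltr01.
rewrite /Gamma -[RHS]divr1 -[X in _ / X](expr1n R 1) -[X in X / _]/(0`!%:R) -h.
apply: eq_Rintegral_halfline => t t0; rewrite subrr powRr0 expr0 mulN1r.
by [].
Qed.

End gamma.

(** * Centred Bernoulli polynomials and the Taylor remainders of phi *)

Section bernoulli_remainder.
Context {R : realType}.
Implicit Types (p : {poly R}) (x y z a b : R) (M : nat).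

Lemma mean_value (f f' : R -> R) a b : a < b ->
  (forall x, a <= x <= b -> is_derive x 1 f (f' x)) ->
  exists2 c, a < c < b & f b - f a = f' c * (b - a).
Proof.
move=> ab df; have [| |c] := @MVT R f f' a b ab.
- by move=> x; rewrite in_itv/= => /andP[ax xb]; apply: df; rewrite !ltW.
- apply: continuous_in_subspaceT => x; rewrite inE/= in_itv/= => axb.
  exact: is_derive1_continuous (df _ axb).
by rewrite in_itv/= => cab fc; exists c.
Qed.

Definition poly_prim p : {poly R} :=
  \poly_(i < (size p).+1) (if i is j.+1 then p`_j / j.+1%:R else 0).

Lemma deriv_poly_prim p : (poly_prim p)^`() = p.
Proof.
apply/polyP => i; rewrite coef_deriv coef_poly ltnS; case: ltnP => ip.
  by rewrite -[LHS]mulr_natr divfK// pnatr_eq0.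
by rewrite mul0rn nth_default.
Qed.

Lemma poly_prim0 p : (poly_prim p).[0] = 0.
Proof. by rewrite horner_coef0 coef_poly. Qed.

(* bodd M and beven M are the Bernoulli polynomials of degree 2M+1 and 2M,
   divided by the factorial of the degree and centred at 1/2. *)
Fixpoint bodd M : {poly R} := if M is N.+1 then
    let q := poly_prim (poly_prim (bodd N)) in q - (2 * q.[2^-1]) *: 'X
  else 'X.

Definition beven M : {poly R} := (bodd M)^`().

Definition bcoef M : R := (beven M).[2^-1].

Lemma bodd0 M : (bodd M).[0] = 0.
Proof.
case: M => [|M] /=; first by rewrite hornerX.
by rewrite !hornerE poly_prim0 subr0.
Qed.

Lemma bodd_half M : (bodd M.+1).[2^-1] = 0.
Proof. by rewrite /= !hornerE mulrAC mulfV ?mul1r ?subrr// pnatr_eq0. Qed.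

Lemma deriv_beven M : (beven M.+1)^`() = bodd M.
Proof.
rewrite /beven /= derivB derivZ derivX deriv_poly_prim derivB deriv_poly_prim.
by rewrite derivZ -[1 : {poly R}]/(1%:P) derivC scaler0 subr0.
Qed.

(* The second derivative of bodd (M+1) is bodd M, so up to sign bodd (M+1) is strictly
   concave between its zeros 0 and 1/2. *)
Lemma bodd_sign M y : 0 < y -> y < 2^-1 -> 0 < (-1) ^+ M * (bodd M).[y].
Proof.
elim: M y => [|M IH] y y0 y1; first by rewrite expr0 mul1r hornerX.
pose s : R := (-1) ^+ M.+1.
pose g x := s * (bodd M.+1).[x]; pose g' x := s * (beven M.+1).[x].
have dg x : is_derive x 1 g (g' x).
  by rewrite /g /g'; derive.
have dg' x : is_derive x 1 g' (s * (bodd M).[x]).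
  by rewrite /g'; derive; rewrite deriv_beven.
have g0 : g 0 = 0 by rewrite /g bodd0 mulr0.
have g1 : g 2^-1 = 0 by rewrite /g bodd_half mulr0.
have [c1 /andP[c10 c1y] h1] := mean_value y0 (fun x _ => dg x).
have [c2 /andP[c2y c21] h2] := mean_value y1 (fun x _ => dg x).
have c12 : c1 < c2 by apply: lt_trans c2y.
have [c3 /andP[c31 c32] h3] := mean_value c12 (fun x _ => dg' x).
have lt0 : g' c2 - g' c1 < 0.
  rewrite h3 pmulr_llt0 ?subr_gt0// /s exprS mulN1r mulNr oppr_lt0.
  by apply: IH; [exact: lt_trans c31|exact: lt_trans c21].
rewrite -/s -/(g y) ltNge; apply/negP => gy.
move: h1 h2; rewrite g0 g1 !subr0 sub0r => h1 h2.
have : g' c1 <= 0 by rewrite -(pmulr_lle0 _ y0) -h1.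
have : 0 <= g' c2 by move: y1; rewrite -subr_gt0 => y1; rewrite -(pmulr_lge0 _ y1) -h2 oppr_ge0.
by move: lt0; lra.
Qed.

(** Twice the hyperbolic sine and cosine of z y. *)
Definition sinh2 z y : R := expR (z * y) - expR (- (z * y)).
Definition cosh2 z y : R := expR (z * y) + expR (- (z * y)).

(** Two integrations by parts give this antiderivative in y of [bodd M] times [sinh2 z], normalised
    to vanish at y = 0. *)
Fixpoint bprim M z y : R := if M is N.+1 then
    (bodd M).[y] * cosh2 z y / z - (beven M).[y] * sinh2 z y / z ^+ 2
      + bprim N z y / z ^+ 2
  else y * cosh2 z y / z - sinh2 z y / z ^+ 2.

Lemma bprimS M z : bprim M.+1 z = fun y => (bodd M.+1).[y] * cosh2 z y / z
  - (beven M.+1).[y] * sinh2 z y / z ^+ 2 + bprim M z y / z ^+ 2.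
Proof. by []. Qed.

Lemma is_derive_sinh2 z y : is_derive y 1 (sinh2 z) (z * cosh2 z y).
Proof. by rewrite /sinh2 /cosh2; derive; ring. Qed.

Lemma is_derive_cosh2 z y : is_derive y 1 (cosh2 z) (z * sinh2 z y).
Proof. by rewrite /sinh2 /cosh2; derive; ring. Qed.

Lemma is_derive_bprim M z y : z != 0 ->
  is_derive y 1 (bprim M z) ((bodd M).[y] * sinh2 z y).
Proof.
move=> z0; have ds := is_derive_sinh2 z y; have dc := is_derive_cosh2 z y.
elim: M => [|M IH].
  by rewrite /bprim; derive; rewrite hornerX; field.
by rewrite bprimS; derive; rewrite deriv_beven -/(beven M.+1); field.
Qed.

Lemma bprim0 M z : bprim M z 0 = 0.
Proof.
rewrite /bprim; elim: M => [|M IH]; rewrite /sinh2 mulr0 oppr0 expR0 subrr.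
  by rewrite !mul0r subrr.
rewrite mulr0 mul0r subr0 bodd0 !mul0r add0r.
by move: IH; rewrite /sinh2 => ->; rewrite mul0r.
Qed.

(* brem M z is z^(-2M) times phi z minus its Taylor polynomial of degree 2M-2; bcoef j
   is B_2j / (2j)!. Since brem M z * sinh2 z (1/2) is the integral of bodd M against
   sinh2 z over [0, 1/2], brem M inherits the sign of bodd M. *)
Fixpoint brem M z : R := if M is N.+1 then (brem N z - bcoef M) / z ^+ 2 else phi z.

Lemma sinh2_gt0 z y : 0 < z -> 0 < y -> 0 < sinh2 z y.
Proof.
by move=> z0 y0; rewrite subr_gt0 ltr_expR (@lt_trans _ _ 0) ?oppr_lt0 ?mulr_gt0.
Qed.

(** For M = 0 this is z phi(z) = coth(z/2)/2 - 1/z. In the induction step the boundary term with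
    [bodd] drops out because 1/2 is a zero, and the one with [beven] is exactly the subtracted
    Taylor coefficient. *)
Lemma brem_bprim M z : 0 < z -> brem M z * sinh2 z 2^-1 = bprim M z 2^-1.
Proof.
move=> z0; have zn0 : z != 0 by rewrite gt_eqF.
elim: M => [|M IH].
  rewrite /= /phi /sinh2 /cosh2 expRN.
  have -> : expR z = expR (z * 2^-1) ^+ 2.
    by rewrite -expRM_natl; congr expR; field.
  have : 1 < expR (z * 2^-1) by rewrite expR_gt1 mulr_gt0.
  set u := expR _ => u1.
  by field; rewrite zn0 !gt_eqF//; nra.
rewrite [brem _ _]/= mulrAC mulrBl IH [RHS]/= bodd_half /bcoef; field.
by [].
Qed.

Lemma brem_sign M z : 0 < z -> 0 < (-1) ^+ M * brem M z.
Proof.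
move=> z0; have zn0 : z != 0 by rewrite gt_eqF.
have h0 : (0 : R) < 2^-1 by rewrite invr_gt0.
rewrite -(pmulr_lgt0 _ (sinh2_gt0 z0 h0)) -mulrA brem_bprim//.
have [c /andP[c0 c1]] := mean_value h0 (fun x _ => is_derive_bprim M x zn0).
rewrite bprim0 !subr0 => ->.
by rewrite !mulrA mulr_gt0// mulr_gt0 ?sinh2_gt0// bodd_sign.
Qed.

(** At z = 1 the coefficient is the difference of two consecutive remainders, which have opposite
    signs. *)
Lemma bcoef_sign M : 0 < (-1) ^+ M * bcoef M.+1.
Proof.
have := brem_sign M ltr01; have := brem_sign M.+1 ltr01.
rewrite [brem M.+1 _]/= expr1n divr1 exprS mulN1r mulNr mulrBr; lra.
Qed.

(** Since z^2 [brem M.+1 z] = [brem M z] - [bcoef M.+1] has the sign opposite to [brem M z], the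
    remainder lies strictly between 0 and the next coefficient. This is the source of every
    integrable majorant below for phi and its remainders. *)
Lemma brem_lt M z : 0 < z -> `|brem M z| < `|bcoef M.+1|.
Proof.
move=> z0; have h1 := brem_sign M z0; have := brem_sign M.+1 z0.
have h2 := bcoef_sign M.
rewrite [brem M.+1 _]/= mulrA pmulr_lgt0 ?invr_gt0 ?exprn_gt0//.
rewrite exprS mulN1r mulNr mulrBr => h3.
have e (u : R) : `|u| = `|(-1) ^+ M * u| by rewrite normrMsign.
rewrite (e (brem M z)) (e (bcoef _)) !gtr0_norm//; lra.
Qed.

Lemma phi_gt0 z : 0 < z -> 0 < phi z.
Proof. by move=> /(brem_sign 0); rewrite mul1r. Qed.

Lemma phi_lt z : 0 < z -> phi z < bcoef 1.
Proof.
move=> z0; have := brem_lt 0 z0; have /= := bcoef_sign 0.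
by rewrite mul1r => c0; rewrite !gtr0_norm// phi_gt0.
Qed.

End bernoulli_remainder.

(** * Frullani's integral and the functional equation of Binet's integral *)

Section binet.
Context {R : realType}.
Local Notation leb := (@lebesgue_measure R).
Local Notation D := ([set` `]0%R, +oo[] : set R).
Implicit Types (a b c h t x : R) (n k : nat).

Lemma expRN_integral a : 0 < a ->
  leb.-integrable D (EFin \o (fun t => expR (- a * t))) /\
  \int[leb]_(t in D) expR (- a * t) = a^-1.
Proof.
move=> a0; have [h1 h2] := Xn_expR_integral 0 a0; split.
  by apply: eq_integrable_halfline h1 => t _; rewrite expr0 mul1r.
rewrite expr1 mul1r in h2; rewrite -h2.
by apply: eq_Rintegral_halfline => t _; rewrite expr0 mul1r.
Qed.

Lemma phi_continuous_pos : continuous_pos (@phi R).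
Proof.
apply: (@is_derive_continuous_pos _ _ (fun t => - (t ^+ 2)^-1 * ((expR t - 1)^-1 - t^-1 + 2^-1)
  + t^-1 * (- (expR t / (expR t - 1) ^+ 2) + (t ^+ 2)^-1))) => t t0.
have e0 : expR t - 1 != 0 by rewrite subr_eq0 gt_eqF// expR_gt1.
by rewrite /phi; derive; rewrite ?gt_eqF//; field; rewrite e0 gt_eqF.
Qed.

Lemma phi_expR_integrable x : 0 < x ->
  leb.-integrable D (EFin \o (fun t => phi t * expR (- x * t))).
Proof.
move=> x0; have [I _] := expRN_integral x0.
apply: (dominated_integrable _ (integrableZ_halfline (bcoef 1) I)) => t t0.
  apply: continuousM; first exact: phi_continuous_pos.
  suff : is_derive t 1 (fun t => expR (- x * t)) (- x * expR (- x * t)).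
    exact: is_derive1_continuous.
  by derive; ring.
rewrite ger0_norm; last by apply: mulr_ge0; [exact/ltW/phi_gt0|exact: expR_ge0].
by rewrite ler_wpM2r ?expR_ge0// ltW// phi_lt.
Qed.

Definition binet x : R := \int[leb]_(t in D) (phi t * expR (- x * t)).

Lemma binet_gt0 x : 0 < x -> 0 < binet x.
Proof.
move=> x0; apply: Rintegral_halfline_gt0; first exact: phi_expR_integrable.
by move=> t t0; apply: mulr_gt0; [exact: phi_gt0|exact: expR_gt0].
Qed.

Lemma binet_le x : 0 < x -> binet x <= bcoef 1 / x.
Proof.
move=> x0; have [I <-] := expRN_integral x0; rewrite -RintegralZ_halfline//.
apply: le_Rintegral_halfline; [exact: phi_expR_integrable|exact: integrableZ_halfline|move=> t t0].
by rewrite ler_wpM2r ?expR_ge0// ltW// phi_lt.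
Qed.

Definition frullani a b t : R := (expR (- a * t) - expR (- b * t)) / t.

(** Both sides come from e^u >= 1 + u, with u = (b - a) t and u = (a - b) t. *)
Lemma frullani_bounds a b t : a <= b -> 0 < t ->
  (b - a) * expR (- b * t) <= frullani a b t <= (b - a) * expR (- a * t).
Proof.
move=> ab t0; rewrite /frullani ler_pdivlMr// ler_pdivrMr//; apply/andP; split.
  have -> : - a * t = - b * t + (b - a) * t by ring.
  have := expR_ge1Dx ((b - a) * t); rewrite expRD; have := expR_gt0 (- b * t).
  by move: (expR _) (expR _) => u w; nra.
have -> : - b * t = - a * t + (a - b) * t by ring.
have := expR_ge1Dx ((a - b) * t); rewrite expRD; have := expR_gt0 (- a * t).
by move: (expR _) (expR _) => u w; nra.
Qed.

Lemma is_derive_frullani a b t : t != 0 -> is_derive t 1 (frullani a b)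
  ((b * expR (- b * t) - a * expR (- a * t)) / t -
   (expR (- a * t) - expR (- b * t)) / t ^+ 2).
Proof.
move=> t0; rewrite /frullani; derive => //.
by move: (expR _) (expR _) => u w; field.
Qed.

Lemma frullani_integrable a b : 0 < a -> a <= b ->
  leb.-integrable D (EFin \o frullani a b).
Proof.
move=> a0 ab; have [I _] := expRN_integral a0.
apply: (dominated_integrable _ (integrableZ_halfline (b - a) I)) => t t0.
  have t0' : t != 0 by rewrite gt_eqF.
  exact: (is_derive1_continuous (is_derive_frullani a b t0')).
have /andP[h1 h2] := frullani_bounds ab t0.
rewrite ger0_norm//; apply: le_trans h1.
by rewrite mulr_ge0 ?expR_ge0// subr_ge0.
Qed.

(** The integral and ln b - ln a both lie between (b - a)/b and (b - a)/a, and these differ by (b -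
    a)^2 / (a b). *)
Lemma frullani_error a b : 0 < a -> a <= b ->
  `|\int[leb]_(t in D) frullani a b t - (ln b - ln a)| <= (b - a) ^+ 2 / a ^+ 2.
Proof.
move=> a0 ab; have b0 : 0 < b by apply: lt_le_trans ab.
have [Ia Ea] := expRN_integral a0; have [Ib Eb] := expRN_integral b0.
have If := frullani_integrable a0 ab.
have h1 : (b - a) / b <= \int[leb]_(t in D) frullani a b t.
  rewrite -Eb -RintegralZ_halfline//; apply: le_Rintegral_halfline => //; first exact: integrableZ_halfline.
  by move=> t t0; have /andP[] := frullani_bounds ab t0.
have h2 : \int[leb]_(t in D) frullani a b t <= (b - a) / a.
  rewrite -Ea -RintegralZ_halfline//; apply: le_Rintegral_halfline => //; first exact: integrableZ_halfline.
  by move=> t t0; have /andP[] := frullani_bounds ab t0.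
have h3 : ln b - ln a <= (b - a) / a.
  rewrite -ln_div ?posrE//.
  have -> : b / a = 1 + (b - a) / a by field; rewrite gt_eqF.
  by apply: le_ln1Dx; rewrite (@lt_le_trans _ _ 0)// divr_ge0 ?subr_ge0// ltW.
have h4 : (b - a) / b <= ln b - ln a.
  rewrite -lerN2 opprB -ln_div ?posrE//.
  have -> : a / b = 1 + - ((b - a) / b) by field; rewrite gt_eqF.
  apply: le_ln1Dx; rewrite ltrN2 ltr_pdivrMr// mul1r; lra.
have h5 : (b - a) / a - (b - a) / b <= (b - a) ^+ 2 / a ^+ 2.
  have -> : (b - a) / a - (b - a) / b = (b - a) ^+ 2 / (a * b).
    by field; rewrite !gt_eqF.
  rewrite ler_wpM2l ?sqr_ge0// lef_pV2 ?posrE ?mulr_gt0 ?exprn_gt0//.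
  by rewrite expr2 ler_pM2l.
rewrite ler_norml; lra.
Qed.

Lemma frullani_integralD a b c : 0 < a -> a <= b -> b <= c ->
  \int[leb]_(t in D) frullani a c t =
  \int[leb]_(t in D) frullani a b t + \int[leb]_(t in D) frullani b c t.
Proof.
move=> a0 ab bc; rewrite -RintegralD_halfline.
- by apply: eq_Rintegral_halfline => t t0; rewrite /frullani; ring.
- exact: frullani_integrable.
- by apply: frullani_integrable => //; apply: lt_le_trans ab.
Qed.

(* Both sides are additive in the interval [a, b] and differ by
   O((b - a)^2), so subdividing [a, b] shows that they agree. *)
Lemma frullani_integral a b : 0 < a -> a <= b ->
  \int[leb]_(t in D) frullani a b t = ln b - ln a.
Proof.
move=> a0 ab; have ba : 0 <= b - a by rewrite subr_ge0.
have step k h : 0 <= h ->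
    `|\int[leb]_(t in D) frullani a (a + k%:R * h) t - (ln (a + k%:R * h) - ln a)|
    <= k%:R * (h ^+ 2 / a ^+ 2).
  move=> h0; elim: k => [|k IH].
    rewrite !mul0r addr0 subrr subr0 (_ : \int[leb]_(t in D) _ = 0) ?normr0//.
    rewrite (@eq_Rintegral_halfline _ _ (fun t => 0 * expR (- a * t))).
      by rewrite RintegralZ_halfline ?mul0r//; have [] := expRN_integral a0.
    by move=> t t0; rewrite /frullani subrr !mul0r.
  set u := a + k%:R * h in IH *.
  have au : a <= u by rewrite lerDl mulr_ge0.
  have u0 : 0 < u by apply: lt_le_trans au.
  have -> : a + k.+1%:R * h = u + h by rewrite /u -natr1; ring.
  have uh : u <= u + h by rewrite lerDl.
  rewrite (frullani_integralD a0 au uh).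
  have e2 : u + h - u = h by ring.
  have := frullani_error u0 uh; rewrite e2 => E.
  have E2 : h ^+ 2 / u ^+ 2 <= h ^+ 2 / a ^+ 2.
    rewrite ler_wpM2l ?sqr_ge0// lef_pV2 ?posrE ?exprn_gt0//.
    by rewrite lerXn2r ?nnegrE ?(ltW a0) ?(ltW u0).
  have split5 (u1 u2 u3 u4 u5 : R) :
    u1 + u2 - (u3 - u4) = (u1 - (u5 - u4)) + (u2 - (u3 - u5)) by ring.
  rewrite (split5 _ _ _ _ (ln u)) -natr1 mulrDl mul1r.
  by apply: (le_trans (ler_normD _ _)); apply: lerD; [exact: IH|exact: le_trans E2].
apply/subr0_eq/(@eq0_of_le_inv _ _ ((b - a) ^+ 2 / a ^+ 2)) => n.
have n0 : 0 < n.+1%:R :> R by [].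
have := step n.+1 ((b - a) / n.+1%:R) (divr_ge0 ba (ltW n0)).
have -> : a + n.+1%:R * ((b - a) / n.+1%:R) = b by field; rewrite gt_eqF.
have -> // : n.+1%:R * (((b - a) / n.+1%:R) ^+ 2 / a ^+ 2) = (b - a) ^+ 2 / a ^+ 2 / n.+1%:R.
by field; rewrite !gt_eqF.
Qed.

(** The factor 1 - e^(-t) created by the difference cancels 1/(e^t - 1). What remains is (x + 1/2)
    times a Frullani integrand minus [k], the derivative of -[frullani x (x + 1)]; that function
    rises from -1 at 0 to 0 at infinity, whence the constant 1. *)
Lemma binet_diff x : 0 < x ->
  binet x - binet (x + 1) = (x + 2^-1) * (ln (x + 1) - ln x) - 1.
Proof.
move=> x0; have x1 : 0 < x + 1 by rewrite addr_gt0.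
have xx : x <= x + 1 by rewrite lerDl.
have e1 : x + 1 - x = 1 by ring.
pose k t : R := (x * expR (- x * t) - (x + 1) * expR (- (x + 1) * t)) / t +
   (expR (- x * t) - expR (- (x + 1) * t)) / t ^+ 2.
have kE t : 0 < t -> k t = expR (- x * t) * (x * t * (1 - expR (- t)) +
    (1 - (1 + t) * expR (- t))) / t ^+ 2.
  move=> t0; rewrite /k; have -> : - (x + 1) * t = - x * t + - t by ring.
  by rewrite expRD; field; rewrite gt_eqF.
have k0 t : 0 < t -> 0 <= k t.
  move=> t0; rewrite kE// mulr_ge0 ?invr_ge0 ?sqr_ge0// mulr_ge0 ?expR_ge0//.
  have h := expR_ge1Dx t.
  have h1 : (1 + t) * expR (- t) <= 1.
    by rewrite expRN ler_pdivrMr ?expR_gt0// mul1r.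
  have h2 : expR (- t) <= 1 by rewrite expR_le1 oppr_le0 ltW.
  by rewrite addr_ge0 ?subr_ge0// mulr_ge0 ?subr_ge0// mulr_ge0 ?(ltW x0) ?(ltW t0).
have dk t : 0 < t -> is_derive t 1 k
    ((- x ^+ 2 * expR (- x * t) + (x + 1) ^+ 2 * expR (- (x + 1) * t)) / t
     - 2 * (x * expR (- x * t) - (x + 1) * expR (- (x + 1) * t)) / t ^+ 2
     - 2 * (expR (- x * t) - expR (- (x + 1) * t)) / t ^+ 3).
  move=> t0; rewrite /k; derive; rewrite ?expf_neq0 ?gt_eqF//.
  by move: (expR _) (expR _) => u w; field; rewrite gt_eqF.
have ck : continuous_pos k := is_derive_continuous_pos dk.
have df t : 0 < t -> is_derive t 1 (fun t => - frullani x (x + 1) t) (k t).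
  move=> t0; have t0' : t != 0 by rewrite gt_eqF.
  have d := is_derive_frullani x (x + 1) t0'.
  by rewrite /k; derive; ring.
have f0 : - frullani x (x + 1) t @[t --> (0:R)^'+] --> (- 1 : R).
  apply: (@cvg0_right _ _ (fun t => (x + 1) * t)).
    move=> t t0; have /andP[h1 h2] := frullani_bounds xx t0.
    rewrite e1 !mul1r in h1 h2.
    have h3 : expR (- x * t) <= 1 by rewrite expR_le1 mulNr oppr_le0 ltW// mulr_gt0.
    have := expR_ge1Dx (- (x + 1) * t) => h4.
    rewrite opprK ler_norml; have : 0 < (x + 1) * t by rewrite mulr_gt0.
    rewrite mulNr in h4 h1.
    by move=> h5; apply/andP; split; lra.
  rewrite -[X in _ --> X](mulr0 (x + 1)); apply: cvgM; first exact: cvg_cst.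
  exact: cvg_right_id.
have fy : - frullani x (x + 1) t @[t --> +oo%R] --> (0 : R).
  apply: (@cvg_pinfty_le _ _ _ 1) => t t0.
  rewrite subr0 normrN /frullani normrM (@ger0_norm _ t^-1) ?invr_ge0 ?(ltW t0)//.
  rewrite ler_wpM2r ?invr_ge0 ?(ltW t0)// ltW//.
  have h1 := expR_gt0 (- x * t); have h2 := expR_gt0 (- (x + 1) * t).
  have h3 : expR (- x * t) <= 1 by rewrite expR_le1 mulNr oppr_le0 ltW// mulr_gt0.
  have h4 : expR (- (x + 1) * t) <= 1 by rewrite expR_le1 mulNr oppr_le0 ltW// mulr_gt0.
  by rewrite ltr_norml; apply/andP; split; lra.
have [Ik Ek] := ge0_FTC_halfline k0 ck df f0 fy.
have If := frullani_integrable x0 xx.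
rewrite /binet -RintegralB_halfline; [|exact: phi_expR_integrable..].
transitivity ((x + 2^-1) * \int[leb]_(t in D) frullani x (x + 1) t - \int[leb]_(t in D) k t).
  rewrite -RintegralZ_halfline// -RintegralB_halfline//; last exact: integrableZ_halfline.
  apply: eq_Rintegral_halfline => t t0; rewrite /phi /frullani /k.
  have -> : - (x + 1) * t = - x * t + - t by ring.
  rewrite expRD expRN; have : 1 < expR t by rewrite expR_gt1.
  move: (expR _) (expR _) => u w w1; field.
  by rewrite (gt_eqF t0) subr_eq0 !gt_eqF// (lt_trans _ w1).
by rewrite frullani_integral// Ek; ring.
Qed.

(* Equal to ln Gamma(x) - ln(2 pi) / 2. *)
Definition stirling_binet x : R := (x - 2^-1) * ln x - x + binet x.

Lemma stirling_binetS x : 0 < x ->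
  stirling_binet (x + 1) = stirling_binet x + ln x.
Proof.
by move=> x0; have := binet_diff x0; rewrite /stirling_binet => h; lra.
Qed.

Lemma stirling_binet_prod x n : 0 < x ->
  ln (\prod_(i < n) (x + i%:R)) = stirling_binet (x + n%:R) - stirling_binet x.
Proof.
move=> x0; have xi i : 0 < x + i%:R by rewrite ltr_wpDr.
elim: n => [|n IH]; first by rewrite big_ord0 ln1 addr0 subrr.
rewrite big_ord_recr /= lnM ?posrE ?prodr_gt0// IH -natr1 addrA stirling_binetS//.
by ring.
Qed.

End binet.

(** * Wallis' product and the value of the Stirling function at 1 *)

Section wallis.
Context {R : realType}.
Implicit Types (x : R) (n : nat).

(** Antiderivatives of sin^n from the reduction formula; [wallis n] is then the integral of sin^n
    over [0, pi/2]. *)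
Fixpoint sin_prim n x : R := match n with
  | 0%N => x
  | 1%N => - cos x
  | (m.+1 as k).+1 => (k%:R * sin_prim m x - sin x ^+ k * cos x) / k.+1%:R
  end.

Lemma sin_primSS n : sin_prim n.+2 =
  fun x => (n.+1%:R * sin_prim n x - sin x ^+ n.+1 * cos x) / n.+2%:R.
Proof. by []. Qed.

Lemma is_derive_sin_prim n x : is_derive x 1 (sin_prim n) (sin x ^+ n).
Proof.
have ds := @is_derive_sin R x; have dc := @is_derive_cos R x.
suff : is_derive x 1 (sin_prim n) (sin x ^+ n) /\
       is_derive x 1 (sin_prim n.+1) (sin x ^+ n.+1) by case.
elim: n => [|n [IH1 IH2]].
  split; first exact: is_did.
  by rewrite /sin_prim; derive; rewrite ?opprK ?expr1.
split=> //; rewrite sin_primSS; derive.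
have c2 : cos x * cos x = 1 - sin x * sin x.
  by rewrite -!expr2 -(cos2Dsin2 x); ring.
rewrite /= mulrN opprD opprK -mulrA c2 !exprS; field.
by rewrite gt_eqF// ltr_wpDr.
Qed.

Definition wallis n : R := sin_prim n (pi / 2) - sin_prim n 0.

Lemma wallis0 : wallis 0 = pi / 2.
Proof. by rewrite /wallis /= subr0. Qed.

Lemma wallis1 : wallis 1 = 1.
Proof. by rewrite /wallis /= cos_pihalf cos0 oppr0 opprK add0r. Qed.

Lemma wallisSS n : wallis n.+2 = n.+1%:R / n.+2%:R * wallis n.
Proof.
rewrite /wallis !sin_primSS cos_pihalf sin0 expr0n/= mulr0 mul0r !subr0.
by ring.
Qed.

(** The mean value theorem for the difference of the antiderivatives, whose derivative sin^n -
    sin^(n+1) is nonnegative on [0, pi/2]. *)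
Lemma wallisS_le n : wallis n.+1 <= wallis n.
Proof.
have p0 : 0 < pi / 2 :> R by rewrite divr_gt0 ?pi_gt0.
have [|c /andP[c0 c1] h] := @mean_value R (fun x => sin_prim n x - sin_prim n.+1 x)
  (fun x => sin x ^+ n - sin x ^+ n.+1) _ _ p0.
  move=> x _; have d1 := is_derive_sin_prim n x; have d2 := is_derive_sin_prim n.+1 x.
  by derive.
have s0 : 0 <= sin c.
  apply: sin_ge0_pi; rewrite (ltW c0) (ltW (lt_trans c1 _))//.
  by rewrite ltr_pdivrMr// ltr_pMr ?pi_gt0// ltr1n.
rewrite -subr_ge0 /wallis.
have -> : forall u v w z : R, u - v - (w - z) = (u - w) - (v - z) by move=> *; ring.
rewrite h mulr_ge0//; last by rewrite subr0 ltW.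
by rewrite exprS -{1}(mul1r (sin c ^+ n)) -mulrBl mulr_ge0 ?exprn_ge0// subr_ge0 sin_le1.
Qed.

(** The central binomial coefficient of 2n over n, divided by 4^n. *)
Definition cbin n : R := (2 * n)`!%:R / (n`!%:R ^+ 2 * 4 ^+ n).

Lemma cbin_gt0 n : 0 < cbin n.
Proof. by rewrite divr_gt0 ?mulr_gt0 ?exprn_gt0 ?ltr0n ?fact_gt0. Qed.

Lemma cbinS n : cbin n.+1 = (2 * n).+1%:R / (2 * n).+2%:R * cbin n.
Proof.
have n0 : n`!%:R != 0 :> R by rewrite pnatr_eq0 -lt0n fact_gt0.
have e1 : (2 * n).+1%:R = 2 * n%:R + 1 :> R by rewrite -natr1 natrM.
have e2 : (2 * n).+2%:R = 2 * n%:R + 2 :> R by rewrite -!natr1 natrM; ring.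
have e3 : n.+1%:R = n%:R + 1 :> R by rewrite -natr1.
rewrite /cbin mulnS !add2n !factS (natrM _ (2 * n).+2) (natrM _ (2 * n).+1) (natrM _ n.+1).
rewrite e1 e2 e3 (exprS 4).
have p4 : 4 ^+ n != 0 :> R by rewrite expf_neq0.
move: p4; move: (4 ^+ n) => q q0.
have : 0 <= n%:R :> R by [].
move: n0; move: (n`!%:R) (n%:R) ((2*n)`!%:R) => f m g f0 m0.
field; by rewrite f0 q0 !gt_eqF//; lra.
Qed.

Lemma wallis_even n : wallis (2 * n) = pi / 2 * cbin n.
Proof.
elim: n => [|n IH]; first by rewrite wallis0 /cbin !muln0 fact0 expr1n mulr1 divr1 mulr1.
by rewrite cbinS mulnS add2n wallisSS IH; ring.
Qed.

Lemma wallis_odd n : wallis (2 * n).+1 = ((2 * n).+1%:R * cbin n)^-1.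
Proof.
elim: n => [|n IH].
  by rewrite wallis1 /cbin !muln0 fact0 expr1n expr0 !(mul1r, invr1).
have c0 := cbin_gt0 n.
have n1 : (2 * n).+1%:R != 0 :> R by rewrite pnatr_eq0.
have n2 : (2 * n).+2%:R != 0 :> R by rewrite pnatr_eq0.
have n3 : (2 * n).+3%:R != 0 :> R by rewrite pnatr_eq0.
rewrite cbinS mulnS add2n wallisSS IH.
move: n1 n2 n3; move: (_.+1%:R) (_.+2%:R) (_.+3%:R) => a b e a0 b0 e0; field.
by rewrite a0 b0 e0 gt_eqF.
Qed.

(** Monotonicity of the Wallis integrals at the indices 2n, 2n+1 and 2n+2. *)
Lemma cbin_bounds n : (2 * n).+1%:R^-1 <= pi / 2 * cbin n ^+ 2 <= (2 * n).+2%:R / (2 * n).+1%:R ^+ 2.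
Proof.
have c0 := cbin_gt0 n; have n1 : 0 < (2 * n).+1%:R :> R by [].
have n2 : 0 < (2 * n).+2%:R :> R by [].
have h1 := wallisS_le (2 * n); have := wallisS_le (2 * n).+1.
rewrite wallisSS wallis_odd wallis_even => h2; rewrite wallis_odd wallis_even in h1.
move: c0 n1 n2 h1 h2; move: (cbin n) (_.+1%:R) (_.+2%:R) => c N K c0 n1 n2 h1 h2.
apply/andP; split.
  have -> : N^-1 = (N * c)^-1 * c :> R.
    by field; rewrite !gt_eqF.
  by rewrite expr2 [leRHS]mulrA ler_wpM2r// ltW.
have -> : pi / 2 * c ^+ 2 = N / K * (pi / 2 * c) *
    (c * (K / N)).
  by field; rewrite !gt_eqF.
have -> : K / N ^+ 2 = (N * c)^-1 *
    (c * (K / N)) :> R.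
  by field; rewrite !gt_eqF.
by rewrite ler_wpM2r// mulr_ge0 ?divr_ge0// ltW.
Qed.

Lemma ln_fact n : ln (n`!%:R : R) = stirling_binet (n.+1%:R) - stirling_binet 1.
Proof.
rewrite -natr1 [_ + 1]addrC -stirling_binet_prod//; congr ln.
elim: n => [|n IH]; first by rewrite big_ord0.
by rewrite big_ord_recr/= -IH factS natrM mulrC -natr1 addrC.
Qed.

Lemma ln_cbin n : ln (cbin n) = stirling_binet ((2 * n).+1%:R)
  - 2 * stirling_binet (n.+1%:R) + stirling_binet 1 - n%:R * ln 4.
Proof.
have f m : 0 < m`!%:R :> R by rewrite ltr0n fact_gt0.
rewrite /cbin ln_div ?posrE ?mulr_gt0 ?exprn_gt0// lnM ?posrE ?exprn_gt0//.
have fn := f n; have -> : ln (n`!%:R ^+ 2 : R) = 2 * ln n`!%:R.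
  by rewrite lnXn// mulr_natl.
have -> : ln (4 ^+ n : R) = n%:R * ln 4 by rewrite lnXn// mulr_natl.
rewrite !ln_fact; move: (stirling_binet _) (stirling_binet _) (stirling_binet _) => a b e.
ring.
Qed.

(** Two evaluations of ln [cbin n] are compared, through Wallis' bounds and through factorials. All
    growing terms cancel, and ln(2 pi) + 2A is left with an error O(1/n). *)
Lemma stirling_binet1 : stirling_binet 1 = - (ln (2 * pi) / 2) :> R.
Proof.
have pi0 := @pi_gt0 R.
have b0 : 0 <= bcoef 1 :> R by have := @bcoef_sign R 0; rewrite expr0 mul1r => /ltW.
set A := stirling_binet 1.
suff : ln (2 * pi) + 2 * A = 0 :> R by lra.
(* The part 6 [bcoef 1] absorbs the [binet] terms, of weights 2 and 4, each [binet] value being at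
   most [bcoef 1]/(n+1); the 3 absorbs the errors in the logarithms. *)
apply: (@eq0_of_le_inv R _ (3 + 6 * bcoef 1)) => n.
have m0 : 0 < n.+1%:R :> R by [].
have N0 : 0 < (2 * n).+1%:R :> R by [].
have NE : (2 * n).+1%:R = 2 * n.+1%:R - 1 :> R by rewrite -!natr1 natrM; ring.
have nE : n%:R = n.+1%:R - 1 :> R by rewrite -natr1 addrK.
have J1 := binet_gt0 m0; have J1' := binet_le m0.
have J2 := binet_gt0 N0; have J2' := binet_le N0.
have l1 : ln (2 * n.+1%:R : R) = ln 2 + ln n.+1%:R by rewrite lnM// posrE.
have l4 : ln (4 : R) = 2 * ln 2.
  have -> : (4 : R) = 2 ^+ 2 by rewrite -natrX.
  by rewrite lnXn// mulr_natl.
have lp : ln (2 * pi) = ln (pi / 2) + 2 * ln 2 :> R.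
  rewrite lnM ?posrE// ln_div ?posrE//; ring.
have /andP[h1 h2] := cbin_bounds n.
have c0 := cbin_gt0 n.
have := ln_cbin n; rewrite -/A l4 nE /stirling_binet => E.
(* With N = 2n + 1, the logarithm of (N+1)/N lies between 1/(N+1) and 1/N. *)
have q1 : ln (2 * n.+1%:R) - ln (2 * n).+1%:R <= (2 * n).+1%:R^-1 :> R.
  rewrite -ln_div ?posrE ?mulr_gt0//.
  have -> : 2 * n.+1%:R / (2 * n).+1%:R = 1 + (2 * n).+1%:R^-1 :> R.
    have -> : 2 * n.+1%:R = (2 * n).+1%:R + 1 :> R by rewrite NE; ring.
    by rewrite mulrDl divff ?gt_eqF// mul1r.
  by apply: le_ln1Dx; apply: (@lt_trans _ _ 0) => //; rewrite invr_gt0.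
have q2 : (2 * n.+1%:R)^-1 <= ln (2 * n.+1%:R) - ln (2 * n).+1%:R :> R.
  rewrite -lerN2 opprB -ln_div ?posrE ?mulr_gt0//.
  have -> : (2 * n).+1%:R / (2 * n.+1%:R) = 1 + - (2 * n.+1%:R)^-1 :> R.
    by rewrite NE mulrBl divff ?gt_eqF ?mulr_gt0// mul1r.
  apply: le_ln1Dx; rewrite ltrN2 invf_lt1 ?mulr_gt0//.
  have m1 : 1 <= n.+1%:R :> R by rewrite ler1n.
  clear -m1; lra.
have lX (y : R) : 0 < y -> ln (y ^+ 2) = 2 * ln y.
  by move=> y0; rewrite lnXn// mulr_natl.
move: h1; rewrite -ler_ln ?posrE ?mulr_gt0 ?invr_gt0 ?exprn_gt0// ?divr_gt0//.
rewrite lnV ?posrE// lnM ?posrE ?divr_gt0 ?exprn_gt0// (lX _ c0) => h1.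
move: h2; rewrite -ler_ln ?posrE ?mulr_gt0 ?invr_gt0 ?exprn_gt0// ?divr_gt0//.
rewrite lnM ?posrE ?divr_gt0 ?exprn_gt0// [ln (_.+2%:R / _)]ln_div ?posrE ?exprn_gt0// (lX _ c0) (lX _ N0) => h2.
have KE : (2 * n).+2%:R = 2 * n.+1%:R :> R by rewrite -!natr1 natrM; ring.
rewrite KE in h2.
have Ninv : (2 * n).+1%:R^-1 <= n.+1%:R^-1 :> R.
  by rewrite lef_pV2 ?posrE// ler_nat ltnS leq_pmull.
have minv : 0 < n.+1%:R^-1 :> R by rewrite invr_gt0.
have u1 : (2 * n).+1%:R * (ln (2 * n.+1%:R) - ln (2 * n).+1%:R) <= 1 :> R.
  by rewrite mulrC -ler_pdivlMr// mul1r.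
have u2 : 1 - (2 * n).+1%:R * (ln (2 * n.+1%:R) - ln (2 * n).+1%:R) <= n.+1%:R^-1 / 2 :> R.
  have := ler_wpM2l (ltW N0) q2; set Nu := (X in _ <= X).
  have -> : (2 * n).+1%:R * (2 * n.+1%:R)^-1 = 1 - n.+1%:R^-1 / 2 :> R.
    by rewrite NE; move: (n.+1%:R) m0 => m m0; field; rewrite gt_eqF.
  by rewrite !lerBlDr addrC.
have E2 : 2 * ln (cbin n) = - ln (2 * n).+1%:R
    - 2 * ((2 * n).+1%:R * (ln (2 * n.+1%:R) - ln (2 * n).+1%:R))
    + 2 * ln 2 + 2 + 2 * binet (2 * n).+1%:R - 4 * binet n.+1%:R + 2 * A.
  by rewrite E l1 NE; field.
have bN : bcoef 1 / (2 * n).+1%:R <= bcoef 1 / n.+1%:R :> R by rewrite ler_wpM2l.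
have -> : (3 + 6 * bcoef 1) / n.+1%:R = 3 * n.+1%:R^-1 + 6 * (bcoef 1 / n.+1%:R) :> R.
  by ring.
rewrite lp; set Nu := (2 * n).+1%:R * _ in u1 u2 E2; clearbody Nu.
set m' := n.+1%:R^-1 in u2 q1 q2 Ninv minv *; set N' := (2 * n).+1%:R^-1 in q1 h1 Ninv.
set bm := bcoef 1 / _ in J1' bN *; set bM := bcoef 1 / _ in J2' bN.
set lm := ln (2 * n.+1%:R) in q1 q2 h2; set lN := ln (2 * n).+1%:R in q1 q2 h1 h2 E2.
set Jm := binet n.+1%:R in J1 J1' E2; set JN := binet _ in J2 J2' E2.
set lc := ln (cbin n) in h1 h2 E2; set l2 := ln (pi / 2) in h1 h2 *.
clearbody m' N' bm bM lm lN Jm JN lc l2 A.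
clear -q1 h1 h2 E2 u1 u2 J1 J2 J1' J2' Ninv minv bN.
by rewrite ler_norml; apply/andP; split; lra.
Qed.

End wallis.

(** * The negative binomial law and its mean absolute deviation *)

Section nbinom.
Context {R : realType}.
Variables (r p : R).
Hypotheses (r_gt0 : 0 < r) (p_gt0 : 0 < p) (p_lt1 : p < 1).
Implicit Types (k n : nat) (x : R).
Let q := 1 - p.

Let q_gt0 : 0 < q. Proof. by rewrite subr_gt0. Qed.

Let rk_gt0 k : 0 < r + k%:R. Proof. by rewrite ltr_wpDr. Qed.

(** The coefficient of x^k in (1 - x)^(-r). *)
Definition rising_coef k : R := \prod_(i < k) (r + i%:R) / k`!%:R.

Lemma rising_coef_gt0 k : 0 < rising_coef k.
Proof. by rewrite divr_gt0 ?prodr_gt0// ltr0n fact_gt0. Qed.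

Lemma rising_coefS k : k.+1%:R * rising_coef k.+1 = (r + k%:R) * rising_coef k.
Proof.
rewrite /rising_coef big_ord_recr/= factS natrM.
by field; rewrite !gt_eqF ?ltr0n ?fact_gt0// ltr_wpDr.
Qed.

Lemma nb_pmfE k : nb_pmf r p k = rising_coef k * p `^ r * q ^+ k.
Proof.
rewrite /nb_pmf -/q; congr (_ * _ * _).
have G0 := Gamma_gt0 r_gt0.
have -> : Gamma (k%:R + 1 : R) = k`!%:R.
  elim: k => [|k IH]; first by rewrite add0r Gamma1.
  by rewrite GammaS// -natr1 IH factS natrM natr1.
have -> : Gamma (k%:R + r) = \prod_(i < k) (r + i%:R) * Gamma r.
  elim: k => [|k IH]; first by rewrite add0r big_ord0 mul1r.
  have h := rk_gt0 k; rewrite addrC in h.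
  by rewrite -natr1 addrAC (GammaS h) big_ord_recr/= IH; ring.
by rewrite /rising_coef; field; rewrite !gt_eqF ?ltr0n ?fact_gt0.
Qed.

Lemma rising_coef0 : rising_coef 0 = 1.
Proof. by rewrite /rising_coef big_ord0 mul1r invr1. Qed.

(* The ratio of consecutive terms is q (n + r) / n, which tends to q < 1. *)
Lemma rising_coef_cvg0 : (n%:R * rising_coef n * q ^+ n) @[n --> \oo] --> (0 : R).
Proof.
pose u n := n%:R * rising_coef n * q ^+ n.
have u0 n : 0 <= u n.
  have c0 := rising_coef_gt0 n.
  apply: mulr_ge0; last by rewrite exprn_ge0 ?(ltW q_gt0).
  by apply: mulr_ge0 => //; exact: ltW.
(* The midpoint of q and 1: s - q = p/2, so q (r + n)/n <= s as soon as n >= 2 q r / p, which fixes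
   [N]. *)
pose s := (1 + q) / 2.
have s0 : 0 < s by rewrite /s; have := q_gt0; lra.
have s1 : s < 1 by rewrite /s /q; have := p_gt0; lra.
pose N := (Num.truncn (2 * q * r / p)).+1.
have step n : (N <= n)%N -> u n.+1 <= s * u n.
  move=> Nn; have n0 : 0 < n%:R :> R by rewrite ltr0n (leq_trans _ Nn).
  have -> : u n.+1 = (r + n%:R) * q / n%:R * u n.
    by rewrite /u rising_coefS exprS; field; rewrite gt_eqF.
  rewrite ler_wpM2r// ler_pdivrMr//.
  have : 2 * q * r <= n%:R * p.
    rewrite -ler_pdivrMr// ltW// (lt_le_trans (truncnS_gt _))//.
    by rewrite ler_nat.
  by rewrite /s /q; lra.
have bnd n : u (n + N)%N <= s ^+ n * u N.
  elim: n => [|n IH]; first by rewrite add0n mul1r.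
  rewrite addSn; apply: (le_trans (step _ (leq_addl _ _))).
  by rewrite exprS -mulrA ler_wpM2l// ltW.
rewrite -(cvg_shiftn N) /=.
apply: (@squeeze_cvgr _ _ _ _ (fun=> 0) (fun n => s ^+ n * u N)).
- by near=> n; rewrite u0 bnd.
- exact: cvg_cst.
- rewrite -[X in _ --> X](mul0r (u N)); apply: cvgM; last exact: cvg_cst.
  by apply: cvg_expr; rewrite ger0_norm ?(ltW s0).
Unshelve. all: by end_near. Qed.

(** With the full series the product would be constantly 1. For the truncated sum, the recurrence of
    the coefficients makes the derivative telescope to a single boundary term. *)
Lemma is_derive_rising_sum n x : x < 1 ->
  is_derive x 1 (fun x => (1 - x) `^ r * \sum_(k < n) rising_coef k * x ^+ k)
    (- (n%:R * rising_coef n * x ^+ n.-1 * (1 - x) `^ (r - 1))).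
Proof.
move=> x1; have x10 : 0 < 1 - x by rewrite subr_gt0.
have dS m : is_derive x 1 (fun x => \sum_(k < m) rising_coef k * x ^+ k)
    (\sum_(k < m) rising_coef k * (k%:R * x ^+ k.-1)).
  elim: m => [|m IH].
    rewrite (_ : (fun _ => _) = fun=> 0); last by apply/funext => y; rewrite big_ord0.
    by rewrite big_ord0; exact: is_dcst.
  rewrite (_ : (fun _ => _) = fun x => \sum_(k < m) rising_coef k * x ^+ k
      + rising_coef m * x ^+ m); last by apply/funext => y; rewrite big_ord_recr.
  by rewrite big_ord_recr/=; derive.
have d := dS n; derive => //.
have -> : (1 - x) `^ r = (1 - x) * (1 - x) `^ (r - 1).
  by rewrite mulr_powRB1// ltW.
suff : (1 - x) * (\sum_(k < n) rising_coef k * (k%:R * x ^+ k.-1))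
   - r * \sum_(k < n) rising_coef k * x ^+ k = - (n%:R * rising_coef n * x ^+ n.-1).
  move=> e; transitivity ((1 - x) `^ (r - 1) * ((1 - x) * (\sum_(k < n) rising_coef k * (k%:R * x ^+ k.-1))
   - r * \sum_(k < n) rising_coef k * x ^+ k)); first by ring.
  by rewrite e; ring.
elim: n {d} => [|n IH]; first by rewrite !big_ord0; ring.
rewrite !big_ord_recr/= rising_coefS.
transitivity (((1 - x) * (\sum_(k < n) rising_coef k * (k%:R * x ^+ k.-1))
   - r * \sum_(k < n) rising_coef k * x ^+ k) + (1 - x) * (rising_coef n * (n%:R * x ^+ n.-1))
   - r * (rising_coef n * x ^+ n)); first by ring.
rewrite IH; case: n {IH} => [|n]; first by rewrite !mul0r; ring.
by rewrite /= exprS; ring.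
Qed.

(** The product (1 - x)^r times the partial sum is 1 at x = 0 and the partial sum of the masses at x
    = q; the mean value theorem bounds the gap by a null sequence. *)
Lemma nb_pmf_sum : (\sum_(k < n) nb_pmf r p k) @[n --> \oo] --> (1 : R).
Proof.
(* A bound for (1 - c)^(r-1) with p <= 1 - c <= 1; which of the two values serves depends on the
   sign of r - 1. *)
pose K := Num.max 1 (p `^ (r - 1)).
have K0 : 0 <= K by rewrite /K le_max ler01.
have bnd n : `|\sum_(k < n.+1) nb_pmf r p k - 1| <= K * (n.+1%:R * rising_coef n.+1 * q ^+ n.+1).
  have q1 : q < 1 by rewrite /q; have := p_gt0; lra.
  have [|c /andP[c0 cq] h] := @mean_value R (fun x => (1 - x) `^ r * \sum_(k < n.+1) rising_coef k * x ^+ k)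
     (fun x => - (n.+1%:R * rising_coef n.+1 * x ^+ n * (1 - x) `^ (r - 1))) 0 q q_gt0.
    by move=> x /andP[_ xq]; apply: (is_derive_rising_sum n.+1); exact: le_lt_trans q1.
  move: h; rewrite subr0 powR1 mul1r.
  have -> : \sum_(k < n.+1) rising_coef k * 0 ^+ k = 1.
    rewrite big_ord_recl/= expr0 mulr1 big1 ?addr0; last by move=> i _; rewrite expr0n mulr0.
    by rewrite rising_coef0.
  have -> : (1 - q) `^ r * \sum_(k < n.+1) rising_coef k * q ^+ k = \sum_(k < n.+1) nb_pmf r p k.
    rewrite mulr_sumr; apply: eq_bigr => k _; rewrite nb_pmfE /q subKr; ring.
  move=> ->; rewrite subr0 mulNr normrN.
  have c1 : 0 < 1 - c by rewrite subr_gt0 (lt_trans cq).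
  have pc : p <= 1 - c by move: cq; rewrite /q; lra.
  have kc : (1 - c) `^ (r - 1) <= K.
    rewrite /K le_max; have [r1|r1] := leP 1 r.
      apply/orP; left; apply: (@le_trans _ _ (1 `^ (r - 1))); last by rewrite powR1.
      have r10 : 0 <= r - 1 by rewrite subr_ge0.
      by apply: (ge0_ler_powR r10); rewrite ?nnegrE ?(ltW c1)//; lra.
    apply/orP; right; rewrite -(opprB 1 r) !powRN lef_pV2 ?posrE ?powR_gt0//.
    have r10 : 0 <= 1 - r by rewrite subr_ge0 ltW.
    by apply: (ge0_ler_powR r10); rewrite ?nnegrE ?(ltW c1) ?(ltW p_gt0).
  have a0 : 0 <= n.+1%:R * rising_coef n.+1.
    by apply: mulr_ge0 => //; exact/ltW/rising_coef_gt0.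
  move: (n.+1%:R * _) a0 => a a0.
  rewrite ger0_norm; last by rewrite !mulr_ge0 ?exprn_ge0 ?powR_ge0 ?(ltW c0) ?(ltW q_gt0).
  have cn : c ^+ n <= q ^+ n by rewrite lerXn2r ?nnegrE ?(ltW c0) ?(ltW cq) ?(ltW q_gt0).
  have := ler_pM (exprn_ge0 n (ltW c0)) (powR_ge0 _ _) cn kc => h.
  have := ler_wpM2l (mulr_ge0 a0 (ltW q_gt0)) h.
  by rewrite exprS; congr (_ <= _); ring.
rewrite -cvg_shiftS; apply: cvg_nat_le bnd _.
rewrite -[X in _ --> X](mulr0 K); apply: cvgM; first exact: cvg_cst.
by rewrite (cvg_shiftS (fun n => n%:R * rising_coef n * q ^+ n)); exact: rising_coef_cvg0.
Qed.

(* A discrete antiderivative of (mu - k) f(k): the absolute deviation telescopes on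
   each side of mu. *)
Definition nb_tail k : R := k%:R * nb_pmf r p k / p.

Lemma nb_tailS k : nb_tail k.+1 = nb_tail k + (r * q / p - k%:R) * nb_pmf r p k.
Proof.
rewrite /nb_tail !nb_pmfE.
have h := rising_coefS k; rewrite exprS.
transitivity ((k.+1%:R * rising_coef k.+1) * (p `^ r * q ^+ k * q / p)); first by ring.
rewrite h; move: (rising_coef k) (q ^+ k) (p `^ r) => a b c.
by rewrite /q; field; rewrite gt_eqF.
Qed.

Lemma nb_tail_cvg0 : nb_tail n @[n --> \oo] --> (0 : R).
Proof.
rewrite (_ : nb_tail = fun n => (p `^ r / p) * (n%:R * rising_coef n * q ^+ n)).
  rewrite -[X in _ --> X](mulr0 (p `^ r / p)); apply: cvgM; first exact: cvg_cst.
  exact: rising_coef_cvg0.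
by apply/funext => n; rewrite /nb_tail nb_pmfE; ring.
Qed.

Section absolute_deviation.
Variable m : nat.
Hypothesis mE : r * q / p = m%:R.

Lemma nb_abs_dev_sum j : \sum_(k < m + j) `|k%:R - m%:R| * nb_pmf r p k =
  2 * nb_tail m - nb_tail (m + j).
Proof.
have low n : (n <= m)%N -> \sum_(k < n) `|k%:R - m%:R| * nb_pmf r p k = nb_tail n.
  elim: n => [|n IH] nm; first by rewrite big_ord0 /nb_tail !mul0r.
  rewrite big_ord_recr/= IH ?(ltnW nm)// nb_tailS mE distrC ger0_norm//.
  by rewrite subr_ge0 ler_nat ltnW.
elim: j => [|j IH]; first by rewrite addn0 low//; ring.
rewrite addnS big_ord_recr/= IH nb_tailS mE ger0_norm; first by ring.
by rewrite subr_ge0 ler_nat leq_addr.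
Qed.

Lemma nb_abs_dev_cvg : \sum_(k < n) `|k%:R - m%:R| * nb_pmf r p k @[n --> \oo] -->
  2 * nb_tail m.
Proof.
have h : 2 * nb_tail m - nb_tail (n + m) @[n --> \oo] --> 2 * nb_tail m - 0.
  apply: cvgB; first exact: cvg_cst.
  by rewrite (cvg_shiftn m nb_tail); exact: nb_tail_cvg0.
rewrite subr0 in h; rewrite -(cvg_shiftn m).
rewrite [X in X @ _ --> _](_ : _ = fun n => 2 * nb_tail m - nb_tail (n + m)) //.
by apply/funext => n /=; rewrite addnC nb_abs_dev_sum.
Qed.

Variables (d : measure_display) (T : measurableType d) (P : probability T R).
Variable X : {RV P >-> R}.
Hypothesis hX : has_nb_law X r p.
Let mu := distribution P X.
Let pt k : set R := [set k%:R].

Let mpt k : measurable (pt k). Proof. exact: measurable_set1. Qed.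

Let tpt : trivIset setT pt.
Proof.
apply/trivIsetP => i j _ _ ij; rewrite -subset0 => x [-> /= /eqP].
by rewrite eqr_nat (negbTE ij).
Qed.

(** The disjoint points k already carry the total mass 1. *)
Lemma nb_law_support : mu (~` \bigcup_k pt k) = 0%E.
Proof.
have mS : measurable (\bigcup_k pt k) by exact: bigcup_measurable.
have -> : mu (~` \bigcup_k pt k) = (1 - mu (\bigcup_k pt k))%E.
  exact: probability_setC.
suff -> : mu (\bigcup_k pt k) = 1%E by rewrite subee.
have -> : mu (\bigcup_k pt k) = (\sum_(k <oo) mu (pt k))%E.
  rewrite /mu measure_bigcup//; apply: eq_eseriesl => i; exact: in_setT.
under eq_eseriesr => k _ do rewrite (hX k : mu (pt k) = _).
apply/cvg_lim => //; rewrite (_ : (fun _ => _) = fun n => (\sum_(k < n) nb_pmf r p k)%:E).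
  by apply: cvg_EFin; [exact: nearW|exact: nb_pmf_sum].
by apply/funext => n; rewrite big_mkord -sumEFin.
Qed.

(** The expectation is moved to the law of X, the null complement of the naturals is discarded, and
    the integral splits over the atoms into the series summed above. *)
Lemma nb_mean_abs_dev : mean_abs_dev X m%:R = (2 * nb_tail m)%:E.
Proof.
rewrite /mean_abs_dev unlock.
pose f (y : R) : \bar R := (`|y - m%:R|)%:E.
have mf : measurable_fun setT f.
  apply/measurable_EFinP; apply: measurableT_comp; first exact: normr_measurable.
  exact: (measurable_funB (@measurable_id _ _ setT) (measurable_cst _)).
transitivity (\int[mu]_y f y)%E; first by rewrite /mu ge0_integral_distribution// => y; rewrite lee_fin.
have mS : measurable (\bigcup_k pt k) by exact: bigcup_measurable.
transitivity (\int[mu]_(y in setT `\` ~` \bigcup_k pt k) f y)%E.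
  apply: ge0_negligible_integral => //; first exact: measurableC.
    by move=> y _; rewrite lee_fin.
  exact: nb_law_support.
rewrite setTD setCK /mu ge0_integral_bigcup//; last 2 first.
- exact: measurable_funTS.
- by move=> y _; rewrite lee_fin.
apply/cvg_lim => //; rewrite (_ : (fun _ => _) =
  fun n => (\sum_(k < n) `|k%:R - m%:R| * nb_pmf r p k)%:E).
  by apply: cvg_EFin; [exact: nearW|exact: nb_abs_dev_cvg].
apply/funext => n; rewrite big_mkord -sumEFin; apply: eq_bigr => k _.
transitivity (\int[mu]_(x in pt k) (cst (`|k%:R - m%:R|)%:E) x)%E.
  by apply: eq_integral => x; rewrite inE => ->.
by rewrite integral_cst// EFinM -(hX k : mu (pt k) = _).
Qed.

End absolute_deviation.
End nbinom.

(** * Power series coefficients and Bernoulli numbers *)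

Section power_series.
Context {R : realType}.
Implicit Types (a : nat -> R) (f g : R -> R) (z c : R) (k n M : nat).

(** One-sided, because the estimates on [brem] hold for z > 0; the values on a right neighbourhood
    of 0 still determine the coefficients. *)
Definition has_series a f := exists2 e : R, 0 < e &
  forall z, 0 < z < e -> series (fun k => a k * z ^+ k) @ \oo --> f z.

Lemma eq_has_series a f g : (forall z, 0 < z -> f z = g z) ->
  has_series a f -> has_series a g.
Proof.
move=> fg [e e0 h]; exists e => // z ze; rewrite -fg; first exact: h.
by have /andP[] := ze.
Qed.

Lemma has_series_shift a f : has_series a f ->
  has_series (fun k => a k.+1) (fun z => (f z - a 0%N) / z).
Proof.
move=> [e e0 h]; exists e => // z ze; have /andP[z0 _] := ze.
have := h z ze; rewrite -cvg_shiftS => {}h.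
rewrite (_ : series _ = fun n => (series (fun k => a k * z ^+ k) n.+1 - a 0%N) / z).
  by apply: cvgM; [apply: cvgB => //; exact: cvg_cst|exact: cvg_cst].
apply/funext => n; rewrite /series/= big_nat_recl// expr0 mulr1 addrAC subrr add0r.
rewrite mulr_suml; apply: eq_bigr => k _.
by rewrite exprS; field; rewrite gt_eqF.
Qed.

(** At one point s of convergence the terms are bounded by some K. For z < s/2 and w = z/s the terms
    of index k >= 1 are at most K w 2^(1-k), so everything beyond the constant term is at most 2 K
    w. *)
Lemma has_series_coef0_near a f : has_series a f ->
  exists2 e : R, 0 < e & exists C : R, forall z, 0 < z < e -> `|f z - a 0%N| <= C * z.
Proof.
move=> [e e0 h]; pose s := e / 2.
have s0 : 0 < s by rewrite divr_gt0.
have se : s < e by rewrite ltr_pdivrMr// ltr_pMr// ltr1n.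
have [K hK] : exists K, forall k, `|a k * s ^+ k| <= K.
  have /cvgP/cvg_series_cvg_0/cvgP/cvg_seq_bounded [K [_ hK]] : series (fun k => a k * s ^+ k) @ \oo --> f s.
    by apply: h; rewrite s0.
  by exists (K + 1) => k; apply: hK => //; rewrite ltrDl.
have K0 : 0 <= K by apply: le_trans (hK 0%N).
exists (s / 2); first by rewrite divr_gt0.
exists (2 * K / s) => z /andP[z0 zs].
have ze : z < e by apply: lt_trans se; apply: lt_trans zs _; rewrite ltr_pdivrMr// ltr_pMr// ltr1n.
pose w := z / s; have w0 : 0 <= w by rewrite divr_ge0// ltW.
have w1 : w <= 2^-1 by rewrite /w ler_pdivrMr// mulrC ltW.
have bnd n : `|series (fun k => a k * z ^+ k) n.+1 - a 0%N| <= K * w * (2 - 2 * 2^-1 ^+ n).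
  elim: n => [|n IH].
    by rewrite /series/= big_nat1 expr0 !mulr1 subrr normr0 subrr mulr0.
  rewrite /series/= big_nat_recr//= addrAC.
  apply: (le_trans (ler_normD _ _)); move: IH; rewrite /series/= => IH.
  have t : `|a n.+1 * z ^+ n.+1| <= K * w * 2^-1 ^+ n.
    have -> : a n.+1 * z ^+ n.+1 = (a n.+1 * s ^+ n.+1) * w ^+ n.+1.
      have {1}-> : z = s * w by rewrite /w; field; rewrite gt_eqF.
      by rewrite exprMn mulrA.
    rewrite normrM (ger0_norm (exprn_ge0 _ w0)) -mulrA ler_pM ?exprn_ge0//.
    by rewrite exprS ler_wpM2l// lerXn2r ?nnegrE.
  apply: (le_trans (lerD IH t)); rewrite le_eqVlt; apply/orP; left; apply/eqP.
  by rewrite exprS; field.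
rewrite (_ : 2 * K / s * z = K * w * 2); last by rewrite /w; field; rewrite gt_eqF.
apply/ler_addgt0Pr => d d0.
have /cvgrPdist_le/(_ _ d0)[N _ hN] := h z (introT andP (conj z0 ze)).
have := hN N.+1 (leqnSn N) => /= h1.
have -> : f z - a 0%N = (series (fun k => a k * z ^+ k) N.+1 - a 0%N) + (f z - series (fun k => a k * z ^+ k) N.+1) by ring.
apply: (le_trans (ler_normD _ _)); apply: lerD h1.
apply: (le_trans (bnd N)); apply: ler_wpM2l; first exact: mulr_ge0.
by rewrite gerBl; apply: mulr_ge0 => //; apply: exprn_ge0; rewrite invr_ge0.
Qed.

Lemma has_series_coef0 a f c C : has_series a f ->
  (forall z, 0 < z < 1 -> `|f z - c| <= C * z) -> a 0%N = c.
Proof.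
move=> /has_series_coef0_near[e e0 [K hK]] hC; apply: subr0_eq.
pose s := Num.min e 1; have s0 : 0 < s by rewrite lt_min e0 ltr01.
apply: (@eq0_of_le_inv R _ ((K + C) * (s / 2))) => n.
pose z := s / 2 / n.+1%:R; have z0 : 0 < z by rewrite !divr_gt0.
have zs : z < s.
  rewrite /z ltr_pdivrMr// (@lt_le_trans _ _ s)//.
    by rewrite ltr_pdivrMr// ltr_pMr// ltr1n.
  by rewrite ler_peMr ?(ltW s0)// ler1n.
move: zs; rewrite lt_min => /andP[ze z1].
have h1 := hK z (introT andP (conj z0 ze)); have h2 := hC z (introT andP (conj z0 z1)).
have -> : a 0%N - c = (f z - c) - (f z - a 0%N) by ring.
apply: (le_trans (ler_normB _ _)).
rewrite (_ : _ / n.+1%:R = C * z + K * z); last by rewrite /z; ring.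
exact: lerD.
Qed.

(** Coefficients are removed two at a time: [brem N z] = [bcoef N.+1] + z^2 [brem N.+1 z] with a
    bounded last factor, so the constant coefficient is [bcoef N.+1] and the linear one is 0. *)
Lemma brem_has_series a : has_series a (brem 0) ->
  forall M, has_series (fun k => a (2 * M + k)%N) (brem M) /\
    a (2 * M)%N = bcoef M.+1 /\ a (2 * M).+1 = 0.
Proof.
move=> h0 M.
have step (b : nat -> R) N : has_series b (brem N) ->
    b 0%N = bcoef N.+1 /\ b 1%N = 0 /\ has_series (fun k => b k.+2) (brem N.+1).
  move=> h.
  have b0 : b 0%N = bcoef N.+1.
    apply: (has_series_coef0 (C := `|bcoef N.+2|) h) => z /andP[z0 z1].
    have -> : brem N z - bcoef N.+1 = z * (z * brem N.+1 z).
      by rewrite /=; field; rewrite gt_eqF.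
    have := brem_lt N.+1 z0; move: (brem N.+1 z) => y yb.
    rewrite !normrM (ger0_norm (ltW z0)) mulrC ler_pM2r//.
    by rewrite -[leRHS]mul1r ler_pM ?(ltW z0) ?(ltW z1) ?(ltW yb).
  have := has_series_shift h; rewrite b0 => {}h.
  have h1 : has_series (fun k => b k.+1) (fun z => z * brem N.+1 z).
    by apply: eq_has_series h => z z0 /=; field; rewrite gt_eqF.
  have b1 : b 1%N = 0.
    apply: (has_series_coef0 (C := `|bcoef N.+2|) h1) => z /andP[z0 z1].
    have := brem_lt N.+1 z0; move: (brem N.+1 z) => y yb.
    by rewrite subr0 normrM (ger0_norm (ltW z0)) mulrC ler_pM2r// ltW.
  split=> //; split=> //; have := has_series_shift h1; rewrite b1 => h2.
  by apply: eq_has_series h2 => z z0; field; rewrite gt_eqF.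
have hs : has_series (fun k => a (2 * M + k)%N) (brem M).
  elim: M => [|M IH]; first by [].
  have [_ [_ h]] := step _ _ IH.
  rewrite (_ : (fun k => a _) = fun k => a (2 * M + k.+2)%N)//.
  by apply/funext => k; congr a; lia.
have [h1 [h2 _]] := step _ _ hs.
by split=> //; rewrite addn0 in h1; rewrite addn1 in h2.
Qed.

(** At t = 0 the generating function is 1 - z/2 + z^2 phi(z). Once the coefficients 1 and -1/2 are
    removed, the series is one for [brem 0]. *)
Lemma bernoulli_coef (B : nat -> {poly R}) : is_bernoulli_polys B ->
  forall M, (B (2 * M.+1)%N).[0] = (2 * M.+1)`!%:R * bcoef M.+1 /\
    (B (2 * M.+1).+1).[0] = 0.
Proof.
move=> hB M; pose a k := (B k).[0] / k`!%:R.
have fk k : k`!%:R != 0 :> R by rewrite pnatr_eq0 -lt0n fact_gt0.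
have h0 : has_series a (fun z => z / (expR z - 1)).
  have /nbhs_ballP[e e0 he] := hB 0.
  exists e => // z /andP[z0 ze].
  have := he z; rewrite /ball/= sub0r normrN (gtr0_norm z0) => /(_ ze).
  rewrite (gt_eqF z0) mul0r expR0 mulr1 => /(_ isT).
  rewrite (_ : (fun k => _) = fun k => a k * z ^+ k)//.
  by apply/funext => k; rewrite /a; field.
have fE z : 0 < z -> z / (expR z - 1) = 1 - z / 2 + z ^+ 2 * phi z.
  move=> z0; rewrite /phi; field; rewrite gt_eqF// subr_eq0 gt_eqF//.
  by rewrite expR_gt1.
have b0 : 0 < bcoef 1 :> R by have := @bcoef_sign R 0; rewrite mul1r.
have phib z : 0 < z -> `|phi z| <= bcoef 1.
  by move=> z0; rewrite gtr0_norm ?phi_gt0// ltW// phi_lt.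
have h0' : has_series a (fun z => 1 - z / 2 + z ^+ 2 * phi z).
  exact: eq_has_series h0.
have a0 : a 0%N = 1.
  apply: (has_series_coef0 (C := 2^-1 + bcoef 1) h0') => z /andP[z0 z1].
  have -> : 1 - z / 2 + z ^+ 2 * phi z - 1 = (z * phi z - 2^-1) * z by ring.
  rewrite normrM (gtr0_norm z0) ler_pM2r//.
  have := phib z z0; rewrite !ler_norml; have := phi_gt0 z0; nra.
have h1 : has_series (fun k => a k.+1) (fun z => - 2^-1 + z * phi z).
  have := has_series_shift h0'; rewrite a0; apply: eq_has_series => z z0.
  by field; rewrite gt_eqF.
have a1 : a 1%N = - 2^-1.
  apply: (has_series_coef0 (C := bcoef 1) h1) => z /andP[z0 z1].
  have -> : - 2^-1 + z * phi z - - 2^-1 = phi z * z by ring.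
  by rewrite normrM (gtr0_norm z0) ler_pM2r// phib.
have h2 : has_series (fun k => a k.+2) (brem 0).
  have := has_series_shift h1; rewrite a1; apply: eq_has_series => z z0.
  by rewrite /=; field; rewrite gt_eqF.
have [_ [e1 e2]] := brem_has_series h2 M.
have E : (2 * M.+1 = (2 * M).+2)%N by lia.
rewrite E; move: e1 e2; rewrite /a => <- e2; split; first by field.
by move/eqP: e2; rewrite mulf_eq0 invr_eq0 (negbTE (fk _)) orbF => /eqP.
Qed.

End power_series.

(** * The integral formula for the logarithm and the bracketing *)

Section deviation_expansion.
Context {R : realType}.
Local Notation leb := (@lebesgue_measure R).
Local Notation D := ([set` `]0%R, +oo[] : set R).
Variables (r p : R).
Hypotheses (r_gt0 : 0 < r) (p_gt0 : 0 < p) (p_lt1 : p < 1).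
Let q := 1 - p.
Let q_gt0 : 0 < q. Proof. by rewrite subr_gt0. Qed.
Let rp_gt0 : 0 < r / p. Proof. exact: divr_gt0. Qed.
Let mu_gt0 : 0 < r * q / p. Proof. by rewrite divr_gt0 ?mulr_gt0. Qed.
Implicit Types (t : R) (M : nat).

Lemma Delta_lt0 t : 0 < t -> Delta p r t < 0.
Proof.
move=> t0; rewrite /Delta -/q.
have h1 : expR (- (r / p) * t) < expR (- r * t).
  rewrite ltr_expR ltr_pM2r// ltrN2 ltr_pdivlMr// gtr_pMr//.
have := expR_gt0 (- (r * q / p) * t); lra.
Qed.

Lemma Xn_Delta_integral n :
  leb.-integrable D (EFin \o (fun t => t ^+ n * Delta p r t)) /\
  \int[leb]_(t in D) (t ^+ n * Delta p r t) =
    n`!%:R * ((r / p) ^- n.+1 - r ^- n.+1 - (r * q / p) ^- n.+1).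
Proof.
have [I1 E1] := Xn_expR_integral n rp_gt0.
have [I2 E2] := Xn_expR_integral n r_gt0.
have [I3 E3] := Xn_expR_integral n mu_gt0.
have I12 := integrableD_halfline I1 (integrableN_halfline I2).
have I := integrableD_halfline I12 (integrableN_halfline I3).
have e t : 0 < t -> t ^+ n * expR (- (r / p) * t) - t ^+ n * expR (- r * t)
    - t ^+ n * expR (- (r * q / p) * t) = t ^+ n * Delta p r t.
  by move=> _; rewrite /Delta -/q; ring.
split; first exact: eq_integrable_halfline I.
by rewrite -(eq_Rintegral_halfline e) !RintegralB_halfline// E1 E2 E3; ring.
Qed.

Lemma brem_continuous_pos M : continuous_pos (@brem R M).
Proof.
elim: M => [|M IH]; first exact: phi_continuous_pos.
move=> t t0; apply: (@continuousM R R (fun t => brem M t - bcoef M.+1) (fun t => (t ^+ 2)^-1)).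
  by apply: continuousB; [exact: IH|exact: cst_continuous].
have t2 : t ^+ 2 != 0 by rewrite expf_neq0// gt_eqF.
have [d dE] : exists d, is_derive t 1 (fun t => (t ^+ 2)^-1) d.
  by eexists; repeat derive_step.
exact: is_derive1_continuous dE.
Qed.

(** The Taylor remainder of phi after M terms, times [Delta]. *)
Let rem M t : R := t ^+ (2 * M) * brem M t * Delta p r t.

Lemma rem_integrable M : leb.-integrable D (EFin \o rem M).
Proof.
have [I _] := Xn_Delta_integral (2 * M).
(* The minus sign makes the majorant positive, [Delta] being negative. *)
apply: (dominated_integrable _ (integrableZ_halfline (- `|bcoef M.+1|) I)) => t t0.
  have [d1' d1] : exists d, is_derive t 1 (fun t => t ^+ (2 * M)) d.
    by eexists; repeat derive_step.
  have [d3 d2] : exists d3, is_derive t 1 (Delta p r) d3.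
    by eexists; rewrite /Delta; repeat derive_step.
  apply: continuousM; last exact: is_derive1_continuous d2.
  apply: continuousM; first exact: is_derive1_continuous d1.
  exact: brem_continuous_pos.
have D0 := Delta_lt0 t0; have b := brem_lt M t0.
have tM : 0 <= t ^+ (2 * M) by rewrite exprn_ge0// ltW.
rewrite /rem; move: (brem M t) b => y yb.
rewrite !normrM (ger0_norm tM) (ltr0_norm D0).
have -> (c : R) : - c * (t ^+ (2 * M) * Delta p r t) = t ^+ (2 * M) * c * - Delta p r t by ring.
apply: ler_wpM2r; first by rewrite oppr_ge0 ltW.
by apply: ler_wpM2l => //; exact: ltW.
Qed.

Lemma rem_sign M : 0 < (-1) ^+ M.+1 * \int[leb]_(t in D) rem M t.
Proof.
rewrite -RintegralZ_halfline; last exact: rem_integrable.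
apply: Rintegral_halfline_gt0; first exact: (integrableZ_halfline _ (rem_integrable M)).
move=> t t0; have D0 := Delta_lt0 t0; have b := brem_sign M t0.
rewrite /rem; move: (brem M t) b => y yb.
have -> : (-1) ^+ M.+1 * (t ^+ (2 * M) * y * Delta p r t) =
  t ^+ (2 * M) * ((-1) ^+ M * y) * - Delta p r t by rewrite exprS; ring.
apply: mulr_gt0; last by rewrite oppr_gt0.
by apply: mulr_gt0 => //; rewrite exprn_gt0.
Qed.

Lemma rem_integralS M : \int[leb]_(t in D) rem M t =
  bcoef M.+1 * ((2 * M)`!%:R * ((r / p) ^- (2 * M).+1 - r ^- (2 * M).+1 - (r * q / p) ^- (2 * M).+1))
  + \int[leb]_(t in D) rem M.+1 t.
Proof.
have [I <-] := Xn_Delta_integral (2 * M).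
rewrite -RintegralZ_halfline// -RintegralD_halfline; [|exact: integrableZ_halfline|exact: rem_integrable].
apply: eq_Rintegral_halfline => t t0; rewrite /rem [brem M.+1 t]/= mulnS exprD.
by move: (brem M t) (Delta p r t) (t ^+ (2 * M)) => x y z; field; rewrite gt_eqF.
Qed.

Lemma rem0E t : rem 0 t = phi t * Delta p r t.
Proof. by rewrite /rem expr0 mul1r. Qed.

Lemma phi_Delta_integrable : leb.-integrable D (EFin \o (fun t => phi t * Delta p r t)).
Proof. by apply: eq_integrable_halfline (rem_integrable 0) => t _; exact: rem0E. Qed.

Lemma phi_Delta_integral : \int[leb]_(t in D) (phi t * Delta p r t) =
  binet (r / p) - binet r - binet (r * q / p).
Proof.
have I1 := phi_expR_integrable rp_gt0.
have I2 := phi_expR_integrable r_gt0.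
have I3 := phi_expR_integrable mu_gt0.
have I12 := integrableD_halfline I1 (integrableN_halfline I2).
rewrite /binet -!RintegralB_halfline//; apply: eq_Rintegral_halfline => t _.
by rewrite /Delta -/q; ring.
Qed.

Lemma atilde_even (B : nat -> {poly R}) j : is_bernoulli_polys B -> (1 <= j)%N ->
  atilde B p (2 * j) 0 = 0.
Proof.
case: j => // j hB _; have [_ h] := bernoulli_coef hB j.
by rewrite /atilde /bernoulli_num h !mulr0 subr0 mulr0.
Qed.

Lemma atilde_odd (B : nat -> {poly R}) j : atilde B p (2 * j.+1 - 1) 0 =
  bernoulli_num B (2 * j.+1) / ((2 * j.+1 - 1)%:R * (2 * j.+1)%:R) *
    (p ^+ (2 * j.+1 - 1) - (p / q) ^+ (2 * j.+1 - 1) - 1).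
Proof.
rewrite /atilde -/q.
have -> : ((2 * j.+1 - 1).+1 = 2 * j.+1)%N by lia.
have -> : (-1) ^+ (2 * j.+1) = 1 :> R by rewrite exprM sqrrN !expr1n.
by rewrite /bernoulli_num; ring.
Qed.

Lemma atilde_odd_sign (B : nat -> {poly R}) j : is_bernoulli_polys B ->
  0 < (-1) ^+ j.+1 * atilde B p (2 * j.+1 - 1) 0.
Proof.
move=> hB; have [h _] := bernoulli_coef hB j.
have s := @bcoef_sign R j.
rewrite atilde_odd /bernoulli_num h.
have neg : p ^+ (2 * j.+1 - 1) - (p / q) ^+ (2 * j.+1 - 1) - 1 < 0.
  have : p ^+ (2 * j.+1 - 1) <= (p / q) ^+ (2 * j.+1 - 1).
    rewrite lerXn2r ?nnegrE ?divr_ge0 ?(ltW p_gt0) ?(ltW q_gt0)//.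
    by rewrite ler_pdivlMr// ler_piMr ?(ltW p_gt0)// /q gerBl ltW.
  lra.
move: (p ^+ _ - _ - 1) neg => A A0.
have f0 : 0 < (2 * j.+1)`!%:R / ((2 * j.+1 - 1)%:R * (2 * j.+1)%:R) :> R.
  by rewrite divr_gt0 ?mulr_gt0 ?ltr0n ?fact_gt0//; lia.
have -> (f e c : R) : (-1) ^+ j.+1 * (f * c / e * A) = (f / e) * ((-1) ^+ j * c) * - A.
  by rewrite exprS; ring.
apply: mulr_gt0; last by rewrite oppr_gt0.
exact: mulr_gt0.
Qed.

(** The moment contributes (2j)! and the Taylor coefficient 1/(2j+2)!; their quotient is the
    denominator (2j+1)(2j+2) of [atilde]. *)
Lemma atilde_odd_integral (B : nat -> {poly R}) j : is_bernoulli_polys B ->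
  atilde B p (2 * j.+1 - 1) 0 / r ^+ (2 * j.+1 - 1) =
  bcoef j.+1 * ((2 * j)`!%:R * ((r / p) ^- (2 * j).+1 - r ^- (2 * j).+1 - (r * q / p) ^- (2 * j).+1)).
Proof.
move=> hB; have [h _] := bernoulli_coef hB j.
rewrite atilde_odd /bernoulli_num h.
have -> : (2 * j.+1 - 1 = (2 * j).+1)%N by lia.
have -> : (2 * j.+1 = (2 * j).+2)%N by lia.
rewrite !factS !natrM; set m := (2 * j).+1.
have m0 : m%:R != 0 :> R by rewrite pnatr_eq0.
have m1 : m.+1%:R != 0 :> R by rewrite pnatr_eq0.
have rm : r ^+ m != 0 by rewrite expf_neq0// gt_eqF.
have pm : p ^+ m != 0 by rewrite expf_neq0// gt_eqF.
have qm : q ^+ m != 0 by rewrite expf_neq0// gt_eqF.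
rewrite !expr_div_n !exprMn.
move: rm pm qm m0 m1; move: (r ^+ m) (p ^+ m) (q ^+ m) (m%:R) (m.+1%:R) => a b c e g a0 b0 c0 e0 g0.
by field; rewrite a0 b0 c0 e0 g0.
Qed.

Lemma log_expansion (B : nat -> {poly R}) M : is_bernoulli_polys B ->
  \int[leb]_(t in D) (phi t * Delta p r t) =
  \sum_(1 <= j < M.+1) atilde B p (2 * j - 1) 0 / r ^+ (2 * j - 1)
  + \int[leb]_(t in D) rem M t.
Proof.
move=> hB; elim: M => [|M IH].
  by rewrite big_geq// add0r; apply: eq_Rintegral_halfline => t _; rewrite rem0E.
by rewrite IH rem_integralS [in RHS]big_nat_recr//= atilde_odd_integral// addrA.
Qed.

(** With S = [stirling_binet] and mu = m + 1, the rising factorial gives S(r/p) - S(r), since r/p =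
    r + mu, and the factorial gives S(mu) + ln mu - S(1). The factor mu of [nb_tail] cancels ln mu,
    S(1) accounts for the pi under the square root, and the elementary parts cancel, leaving the
    three [binet] terms. *)
Lemma log_abs_dev m : r * q / p = m.+1%:R ->
  ln (2 * nb_tail r p m.+1 / (p^-1 * Num.sqrt (2 * r * q / pi))) =
  \int[leb]_(t in D) (phi t * Delta p r t).
Proof.
move=> mE; rewrite phi_Delta_integral mE.
have pi0 := @pi_gt0 R.
have rpE : r / p = r + m.+1%:R by rewrite -mE /q; field; rewrite gt_eqF.
have m0 : 0 < m.+1%:R :> R by [].
have lm : ln (m.+1%:R : R) = ln r + ln q - ln p.
  by rewrite -mE ln_div ?posrE ?mulr_gt0// lnM.
have prod0 : 0 < \prod_(i < m.+1) (r + i%:R) by rewrite prodr_gt0// => i _; rewrite ltr_wpDr.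
have fact0 : 0 < m.+1`!%:R :> R by rewrite ltr0n fact_gt0.
have lprod := stirling_binet_prod m.+1 r_gt0.
have lfact := @ln_fact R m.+1.
have lS := stirling_binetS m0; rewrite natr1 in lS.
have l1 := @stirling_binet1 R.
have lsqrt : ln (Num.sqrt (2 * r * q / pi)) = (ln 2 + ln r + ln q - ln pi) / 2.
  rewrite -powR12_sqrt; last by rewrite divr_ge0 ?mulr_ge0 ?(ltW r_gt0) ?(ltW q_gt0) ?(ltW pi0).
  by rewrite ln_powR ln_div ?posrE ?mulr_gt0// !lnM ?posrE ?mulr_gt0//; ring.
have l2pi : ln (2 * pi) = ln 2 + ln pi :> R by rewrite lnM ?posrE.
rewrite /nb_tail nb_pmfE// /rising_coef -/q.
have pr0 : 0 < p `^ r by rewrite powR_gt0.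
have qm0 : 0 < q ^+ m.+1 by rewrite exprn_gt0.
have lqm : ln (q ^+ m.+1) = m.+1%:R * ln q by rewrite lnXn// mulr_natl.
have s0 : 0 < Num.sqrt (2 * r * q / pi) by rewrite sqrtr_gt0 divr_gt0 ?mulr_gt0.
rewrite ln_div ?posrE ?mulr_gt0 ?invr_gt0//.
rewrite lnM ?posrE ?divr_gt0 ?mulr_gt0//.
rewrite ln_div ?posrE ?mulr_gt0 ?divr_gt0//.
rewrite lnM ?posrE ?mulr_gt0 ?divr_gt0//.
rewrite lnM ?posrE ?mulr_gt0 ?divr_gt0//.
rewrite lnM ?posrE ?mulr_gt0 ?divr_gt0//.
rewrite ln_div ?posrE//.
rewrite lnM ?posrE ?invr_gt0// lnV ?posrE//.
rewrite ln_powR lqm lsqrt lprod lfact lS l1 l2pi -rpE.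
rewrite /stirling_binet ln_div ?posrE// lm rpE.
by field.
Qed.

End deviation_expansion.

Theorem theorem5p3 (R : realType) (B : nat -> {poly R})
    (hB : is_bernoulli_polys B)
    (d : measure_display) (T : measurableType d) (P : probability T R)
    (X : {RV P >-> R}) (r p : R)
    (hr : 0 < r) (hp0 : 0 < p) (hp1 : p < 1)
    (hX : has_nb_law X r p) :
  let q := 1 - p in
  let mu := r * q / p in
  let L := ln (fine (mean_abs_dev X mu) / (p^-1 * Num.sqrt (2 * r * q / pi))) in
  mu \is a Num.int -> 1 <= mu ->
  [/\ mean_abs_dev X mu \is a fin_num,
      L%:E = (\int[lebesgue_measure]_(t in `]0%R, +oo[)
                 (phi t * Delta p r t)%:E)%E
      /\ (forall t : R, 0 < t -> Delta p r t < 0),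
      (forall j : nat, (1 <= j)%N -> atilde B p (2 * j) 0 = 0),
      (forall j : nat, (1 <= j)%N ->
         atilde B p (2 * j - 1) 0 =
           bernoulli_num B (2 * j) / ((2 * j - 1)%:R * (2 * j)%:R) *
             (p ^+ (2 * j - 1) - (p / q) ^+ (2 * j - 1) - 1)
         /\ 0 < (-1) ^+ j * atilde B p (2 * j - 1) 0)
    & (forall M : nat,
         0 < (-1) ^+ M.+1 *
           (L - \sum_(1 <= j < M.+1)
                  atilde B p (2 * j - 1) 0 / r ^+ (2 * j - 1)))].
Proof.
move=> q mu L muZ mu1.
have q0 : 0 < q by rewrite subr_gt0.
have [m mE] : exists m, mu = m.+1%:R.
  have : mu \is a Num.nat by rewrite natrEint muZ (le_trans ler01).
  move=> /natrP[[|m] mE]; last by exists m.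
  by move: mu1; rewrite mE ler10.
have dev : mean_abs_dev X mu = (2 * nb_tail r p m.+1)%:E.
  by rewrite mE; exact: (nb_mean_abs_dev hr hp0 hp1 mE hX).
have LE : L = \int[lebesgue_measure]_(t in [set` `]0%R, +oo[]) (phi t * Delta p r t).
  by rewrite /L dev; exact: (log_abs_dev hr hp0 hp1 mE).
split.
- by rewrite dev.
- split; last by move=> t; exact: Delta_lt0.
  rewrite LE /Rintegral fineK//.
  exact: (integrable_fin_num measurable_halfline (phi_Delta_integrable hr hp0 hp1)).
- by move=> j; exact: atilde_even.
- move=> [//|j] _; split; first exact: atilde_odd.
  exact: atilde_odd_sign.
- move=> M; rewrite LE (log_expansion hr hp0 hp1 M hB) addrAC subrr add0r.
  exact: rem_sign.
Qed.
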